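(* Let $K$ be a compact Lie group with Lie algebra $\mathfrak k$, let $M$ be a $K$-manifold, and let $X$ be a $K$-equivariant vector field on $M$ with a relative equilibrium $m$ with velocity $\xi\in\mathfrak k$. Let $K_m$ be the stabilizer of $m$, with Lie algebra $\mathfrak k_m$, and let $T^d$ be the torus $$T^d:=\overline{\{\exp(\tau\xi)K_m\mid\tau\in\mathbb R\}}$$ in the Lie group $N(K_m)/K_m$, of dimension $d>0$. Let $t_1,\dots,t_d$ be a lattice basis of the Lie algebra $\mathfrak t^d$ of $T^d$, and let $\xi_1,\dots,\xi_d$ be the corresponding coordinates of $\xi+\mathfrak k_m\in\mathfrak t^d$. Let $0\le j\le d$. If $\psi\in C^\infty(M,\mathfrak k)^K$ is an infinitesimal gauge transformation such that $$\psi(m)+\mathfrak k_m=-\xi_{j+1}t_{j+1}-\dots-\xi_dt_d,$$ then $\psi$ stabilizes the frequencies of $X$ at $m$ to order $j$.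
   Context: A $K$-manifold is a smooth manifold with a smooth action of $K$. An infinitesimal gauge transformation is a smooth map $\psi:M\to\mathfrak k$ with $\psi(k\cdot p)=\mathrm{Ad}(k)\psi(p)$; their space is $C^\infty(M,\mathfrak k)^K$. It induces the equivariant vector field $\partial(\psi)(p)=\frac{d}{d\tau}|_0\exp(\tau\psi(p))\cdot p$. A point $m$ is a relative equilibrium of an equivariant vector field $X$ if $X(m)\in T_m(K\cdot m)$; a velocity of $m$ is a vector $\xi\in\mathfrak k$ with $X(m)=\frac{d}{d\tau}|_0\exp(\tau\xi)\cdot m$. One has then $\exp(\tau\xi)\in N(K_m)$ for all $\tau$, where $N(K_m)$ is the normalizer of $K_m$ in $K$. A torus is a compact connected abelian Lie group (the trivial group is a torus of dimension $0$). A lattice basis of the Lie algebra $\mathfrak t$ of an $n$-dimensional torus is a set of $n$ $\mathbb R$-linearly independent vectors whose $\mathbb Z$-span is $\ker(\exp:\mathfrak t\to T)$. Frequency stabilization: the closure $T_m=\overline{\{\phi_m(\tau)\}}$ of the integral curve $\phi_m$ of $X$ starting at the relative equilibrium $m$ is diffeomorphic to a torus; suppose its dimension is $d>0$. For $0\le j\le d$, $\psi\in C^\infty(M,\mathfrak k)^K$ stabilizes the frequencies of $X$ at $m$ to order $j$ if the torus $\overline{\{\varphi_m(\tau)\}}$ has dimension $j$, where $\varphi_m$ is the integral curve of $X+\partial(\psi)$ starting at $m$. *)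

(* Defs.v *)
From HB Require Import structures.
From mathcomp Require Import all_boot all_order all_algebra.
From mathcomp Require Import all_classical all_reals all_analysis.

Set Implicit Arguments.
Unset Strict Implicit.
Unset Printing Implicit Defensive.

Import Order.TTheory GRing.Theory Num.Theory.
Import numFieldNormedType.Exports.

Local Open Scope classical_set_scope.
Local Open Scope ring_scope.

Fixpoint Ck (R : realType) (V W : normedModType R) (k : nat) (f : V -> W)
    (U : set V) : Prop :=
  match k with
  | 0 => forall x, U x -> {for x, continuous f}
  | k'.+1 => (forall x, U x -> differentiable f x) /\
             (forall v, Ck k' (fun x => 'D_v f x) U)
  end.

(* Meant for finite-dimensional V and W and for U open. *)
Definition smooth_on (R : realType) (V W : normedModType R) (f : V -> W)
    (U : set V) : Prop :=
  forall k, Ck k f U.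

Record chart (R : realType) (n : nat) (M : topologicalType) := Chart {
  chart_dom : set M;
  chart_map : M -> 'rV[R]_n;
  chart_inv : 'rV[R]_n -> M;
  chart_dom_open : open chart_dom;
  chart_cod_open : open (chart_map @` chart_dom);
  chart_mapK : forall p, chart_dom p -> chart_inv (chart_map p) = p;
  chart_map_continuous : {within chart_dom, continuous chart_map};
  chart_inv_continuous :
    {within chart_map @` chart_dom, continuous chart_inv}
}.

Definition chart_cod (R : realType) (n : nat) (M : topologicalType)
    (c : chart R n M) : set 'rV[R]_n :=
  chart_map c @` chart_dom c.

Definition smoothly_compatible (R : realType) (n : nat) (M : topologicalType)
    (c c' : chart R n M) : Prop :=
  smooth_on (chart_map c' \o chart_inv c)
            (chart_map c @` (chart_dom c `&` chart_dom c')).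

(* The smooth structure is given by an atlas indexed by the points of the
   manifold, [chart_at p] being a chart around [p].  The tangent space at [p]
   is then 'rV[R]_n, a tangent vector at [p] being identified with its
   coordinates in the chart [chart_at p]. *)
HB.mixin Record isManifold (R : realType) (n : nat) M of Topological M := {
  chart_at : M -> chart R n M;
  chart_at_dom : forall p, chart_dom (chart_at p) p;
  chart_at_compatible :
    forall p q, smoothly_compatible (chart_at p) (chart_at q);
  manifold_hausdorff : hausdorff_space M;
  manifold_second_countable : @second_countable M
}.

#[short(type="manifoldType")]
HB.structure Definition Manifold (R : realType) (n : nat) :=
  { M of isManifold R n M & Topological M }.

Section Smoothness.
Context (R : realType).

Definition smooth_map (n n' : nat) (M : manifoldType R n)
    (N : manifoldType R n') (F : M -> N) : Prop :=
  continuous F /\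
  forall p q, smooth_on
    (chart_map (chart_at q) \o F \o chart_inv (chart_at p))
    (chart_map (chart_at p) @`
       (chart_dom (chart_at p) `&` F @^-1` chart_dom (chart_at q))).

(* Smoothness of a map defined on the product manifold A * B, whose charts are
   the products of the charts of A and of B. *)
Definition smooth_map2 (a b c : nat) (A : manifoldType R a)
    (B : manifoldType R b) (C : manifoldType R c) (F : A -> B -> C) : Prop :=
  continuous (fun xy : A * B => F xy.1 xy.2) /\
  forall p q r, smooth_on
    (fun uv : 'rV[R]_a * 'rV[R]_b => chart_map (chart_at r)
       (F (chart_inv (chart_at p) uv.1) (chart_inv (chart_at q) uv.2)))
    [set uv | [/\ chart_cod (chart_at p) uv.1, chart_cod (chart_at q) uv.2 &
       chart_dom (chart_at r)
         (F (chart_inv (chart_at p) uv.1) (chart_inv (chart_at q) uv.2))]].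

Definition smooth_fun (n k : nat) (M : manifoldType R n)
    (f : M -> 'rV[R]_k) : Prop :=
  forall p : M,
    smooth_on (f \o chart_inv (chart_at p)) (chart_cod (chart_at p)).

(* The differential at p of F, from the tangent space at p to the tangent
   space at F p. *)
Definition tmap (n n' : nat) (M : manifoldType R n) (N : manifoldType R n')
    (F : M -> N) (p : M) (v : 'rV[R]_n) : 'rV[R]_n' :=
  'd (chart_map (chart_at (F p)) \o F \o chart_inv (chart_at p))
     (chart_map (chart_at p) p) v.

(* The coordinates in the chart c of a tangent vector v at p. *)
Definition tcoord (n : nat) (M : manifoldType R n) (c : chart R n M) (p : M)
    (v : 'rV[R]_n) : 'rV[R]_n :=
  'd (chart_map c \o chart_inv (chart_at p)) (chart_map (chart_at p) p) v.

Definition smooth_vector_field (n : nat) (M : manifoldType R n)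
    (X : M -> 'rV[R]_n) : Prop :=
  forall q : M, smooth_on
    (fun u => let p := chart_inv (chart_at q) u in tcoord (chart_at q) p (X p))
    (chart_cod (chart_at q)).

Definition velocity (n : nat) (M : manifoldType R n) (g : R -> M) (t : R)
    : 'rV[R]_n :=
  'D_1 (chart_map (chart_at (g t)) \o g) t.

(* Continuity ensures that g stays near t in the domain of the chart. *)
Definition has_velocity (n : nat) (M : manifoldType R n) (g : R -> M) (t : R)
    (v : 'rV[R]_n) : Prop :=
  {for t, continuous g} /\
  is_derive t 1 (chart_map (chart_at (g t)) \o g) v.

Definition integral_curve (n : nat) (M : manifoldType R n)
    (X : M -> 'rV[R]_n) (m : M) (phi : R -> M) : Prop :=
  phi 0 = m /\ forall t, has_velocity phi t (X (phi t)).

(* The tangent space at m of an embedded submanifold S of M. *)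
Definition tangent_space (n : nat) (M : manifoldType R n) (S : set M) (m : M)
    : set 'rV[R]_n :=
  [set v | exists g : R -> M,
     [/\ g 0 = m, (forall t, S (g t)) & has_velocity g 0 v]].

End Smoothness.

HB.mixin Record Manifold_Group_isLieGroup (R : realType) (n : nat) K
    of Manifold R n K & Group K := {
  lie_mul_smooth : smooth_map2 (fun x y : K => (x * y)%g);
  lie_inv_smooth : smooth_map (fun x : K => x^-1%g)
}.

#[short(type="lieGroupType")]
HB.structure Definition LieGroup (R : realType) (n : nat) :=
  { K of Manifold_Group_isLieGroup R n K & Manifold R n K & Group K }.

(* The Lie algebra of K is the tangent space 'rV[R]_k at 1. *)
Section LieGroups.
Context (R : realType) (k : nat) (K : lieGroupType R k).

Definition one_parameter_subgroup (g : R -> K) (xi : 'rV[R]_k) : Prop :=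
  (forall s t, g (s + t) = (g s * g t)%g) /\ has_velocity g 0 xi.

(* The one-parameter subgroup with velocity xi exists and is unique, so the
   default value of [xget] plays no role. *)
Definition lie_exp (xi : 'rV[R]_k) : K :=
  xget (fun=> 1%g) [set g | one_parameter_subgroup g xi] 1.

Definition Ad (x : K) (xi : 'rV[R]_k) : 'rV[R]_k :=
  tmap (fun y : K => (x * y * x^-1)%g) 1%g xi.

Definition lie_subalgebra (H : set K) : set 'rV[R]_k :=
  [set eta | forall tau : R, H (lie_exp (tau *: eta))].

Definition normalizer (H : set K) : set K :=
  [set x | [set (x * h * x^-1)%g | h in H] = H].

Definition lcoset (x : K) (H : set K) : set K := [set (x * h)%g | h in H].

(* Closed sets for the quotient topology on N / H, a set of cosets being a
   set of subsets of K. *)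
Definition quotient_closed (N H : set K) (C : set (set K)) : Prop :=
  C `<=` [set lcoset x H | x in N] /\
  closed ([set x | C (lcoset x H)] : set (subspace N)).

Definition quotient_closure (N H : set K) (A : set (set K)) : set (set K) :=
  \bigcap_(C in [set C | quotient_closed N H C /\ A `<=` C]) C.

(* The Lie algebra of a closed subgroup T of N / H.  The Lie algebra of N / H
   is n / h, with exponential eta + h |-> exp(eta) H; here and below its
   elements are represented by vectors of n and compared modulo h. *)
Definition quotient_lie_subalgebra (N H : set K) (T : set (set K))
    : set 'rV[R]_k :=
  [set eta | lie_subalgebra N eta /\
             forall tau : R, T (lcoset (lie_exp (tau *: eta)) H)].

Definition free_mod (h : set 'rV[R]_k) (d : nat) (t : 'I_d -> 'rV[R]_k)
    : Prop :=
  forall c : 'I_d -> R, h (\sum_i c i *: t i) -> forall i, c i = 0.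

Definition dim_mod (h A : set 'rV[R]_k) (d : nat) : Prop :=
  exists b : 'I_d -> 'rV[R]_k,
    [/\ forall i, A (b i), free_mod h b &
        forall eta, A eta -> exists c : 'I_d -> R,
          h (eta - \sum_i c i *: b i)].

Definition quotient_dim (N H : set K) (T : set (set K)) (d : nat) : Prop :=
  dim_mod (lie_subalgebra H) (quotient_lie_subalgebra N H T) d.

(* Only meaningful when d is the dimension of T; that is not part of the
   definition and is stated by [quotient_dim]. *)
Definition lattice_basis (N H : set K) (T : set (set K)) (d : nat)
    (t : 'I_d -> 'rV[R]_k) : Prop :=
  let h := lie_subalgebra H in
  let tt := quotient_lie_subalgebra N H T in
  [/\ forall i, tt (t i),
      free_mod h t &
      forall eta, (tt eta /\ lcoset (lie_exp eta) H = H) <->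
                  exists z : 'I_d -> int, h (eta - \sum_i t i *~ z i)].

End LieGroups.

Arguments lie_exp {R k} K xi.

Definition is_torus (R : realType) (n : nat) (T : lieGroupType R n) : Prop :=
  [/\ compact [set: T], connected [set: T] &
      commutative (fun x y : T => (x * y)%g)].

(* As a torus is compact, an injective immersion of it is an embedding. *)
Definition diffeomorphic_to_torus (R : realType) (n : nat)
    (M : manifoldType R n) (S : set M) (j : nat) : Prop :=
  exists (T : lieGroupType R j) (e : T -> M),
    [/\ is_torus T, smooth_map e, injective e,
        forall p v, tmap e p v = 0 -> v = 0 & range e = S].

Section Actions.
Context (R : realType) (k n : nat) (K : lieGroupType R k)
        (M : manifoldType R n).

Definition smooth_action (act : K -> M -> M) : Prop :=
  [/\ forall p, act 1%g p = p,
      forall x y p, act (x * y)%g p = act x (act y p) &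
      smooth_map2 act].

Definition stabilizer (act : K -> M -> M) (m : M) : set K :=
  [set x | act x m = m].

Definition orbit (act : K -> M -> M) (m : M) : set M :=
  [set act x m | x in [set: K]].

Definition equivariant_field (act : K -> M -> M) (X : M -> 'rV[R]_n) : Prop :=
  forall x p, X (act x p) = tmap (act x) p (X p).

Definition infinitesimal_action (act : K -> M -> M) (xi : 'rV[R]_k) (p : M)
    : 'rV[R]_n :=
  velocity (fun tau : R => act (lie_exp K (tau *: xi)) p) 0.

Definition infinitesimal_gauge (act : K -> M -> M) (psi : M -> 'rV[R]_k)
    : Prop :=
  smooth_fun psi /\ forall x p, psi (act x p) = Ad x (psi p).

Definition gauge_field (act : K -> M -> M) (psi : M -> 'rV[R]_k) (p : M)
    : 'rV[R]_n :=
  infinitesimal_action act (psi p) p.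

Definition relative_equilibrium (act : K -> M -> M) (X : M -> 'rV[R]_n)
    (m : M) : Prop :=
  tangent_space (orbit act m) m (X m).

Definition is_velocity (act : K -> M -> M) (X : M -> 'rV[R]_n) (m : M)
    (xi : 'rV[R]_k) : Prop :=
  X m = infinitesimal_action act xi m.

(* The closure in N(K_m) / K_m of the exp(tau xi) K_m. *)
Definition frequency_torus (act : K -> M -> M) (m : M) (xi : 'rV[R]_k)
    : set (set K) :=
  let H := stabilizer act m in
  quotient_closure (normalizer H) H
    [set lcoset (lie_exp K (tau *: xi)) H | tau in [set: R]].

(* The integral curve through m is unique as M is Hausdorff. *)
Definition stabilizes_frequencies (act : K -> M -> M) (X : M -> 'rV[R]_n)
    (m : M) (psi : M -> 'rV[R]_k) (j : nat) : Prop :=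
  exists phi : R -> M,
    integral_curve (fun p => X p + gauge_field act psi p) m phi /\
    diffeomorphic_to_torus (closure (range phi)) j.

End Actions.

(* Main.v *)
(* Write H for the stabilizer of m, N for its normalizer and L for the
   differential at 1 of the orbit map x |-> x.m; then Lie H = ker L.  The curve
   exp(s xi).m and its translates by H are integral curves of X through m, hence
   equal, so exp(s xi) lies in N.  If zeta and eta agree modulo ker L and exp(s eta)
   lies in N, the curve exp(-s zeta).exp(s eta).m has zero velocity, so that
   exp(s zeta).m = exp(s eta).m.  Since the torus T^d is commutative,
   E(s_1, ..., s_d) = exp(s_1 t_1)...exp(s_d t_d).m is an immersion of R^d into M
   which, t being a lattice basis, factors through an injection of R^d / Z^d.  The
   preimage in N of T^d is the smallest closed union of cosets of H containing all
   exp(s xi), and this forces s |-> s (x_1, ..., x_d) to be dense modulo Z^d, hence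
   also its projection to the first j coordinates.  The integral curve of
   X + d(psi) through m is exp(s (xi + psi m)).m = E(s (x_1, ..., x_j, 0, ..., 0)),
   whose closure is therefore the embedded torus E(R^j) = R^j / Z^j. *)

From HB Require Import structures.
Require Import Defs.
From mathcomp Require Import all_boot all_order all_algebra.
From mathcomp Require Import all_classical all_reals all_analysis.
From mathcomp Require Import lra ring.

Set Implicit Arguments.
Unset Strict Implicit.
Unset Printing Implicit Defensive.

Import Order.TTheory GRing.Theory Num.Theory.
Import numFieldNormedType.Exports.

Local Open Scope classical_set_scope.
Local Open Scope ring_scope.

(** * Differential calculus and C^k maps *)

(** The price is that additivity of E has to come from commutation in T^d. Lifts to K commute only
    modulo H, hence all these identities are stated after acting on m. N / H is never made into a
    Lie group: its closed subsets are handled through saturated closed subsets of K, and congruence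
    modulo Lie H as equality of the images under L. The exponential of zeta = xi + psi(m) is not
    known beforehand to lie in N. The zero-velocity argument therefore asks only that the curve
    compared with it take its values in N, and this curve is a lift of E along a line. *)

Lemma near_eq_differentiable (R : numFieldType) (V W : normedModType R)
    (f g : V -> W) (x : V) :
  (\near x, f x = g x) -> differentiable f x ->
  differentiable g x /\ 'd g x = 'd f x :> (V -> W).
Proof.
move=> fg /diff_locallyP[fc fo].
have gx : g x = f x by rewrite (nbhs_singleton fg).
have fg0 : \forall h \near (0 : V), f (h + x) = g (h + x).
  by move: fg; rewrite (near_shift 0 x) /= subr0.
have go : g \o shift x = cst (g x) + 'd f x +o_ 0 id.
  apply/eqaddoP => e e0; move/eqaddoP: fo => /(_ e e0) H.
  near=> h; have -> : (g \o shift x - (cst (g x) + 'd f x)) h =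
     (f \o shift x - (cst (f x) + 'd f x)) h.
    rewrite !fctE /= gx; congr (_ - _); symmetry.
    by near: h.
  by near: h.
have E := diff_unique fc go.
split => //; apply/diff_locallyP; rewrite E; split => //.
Unshelve. all: by end_near. Qed.

Lemma continuous_at_normP (R : realType) (V W : normedModType R) (f : V -> W) (x : V) :
  {for x, continuous f} <-> forall e : R, 0 < e ->
    exists2 d : R, 0 < d & forall y, `|y - x| < d -> `|f y - f x| <= e.
Proof.
split=> [cf e e0|H].
  have /cvgrPdist_le /(_ e e0) /nbhs_ballP[d /= d0 Hd] := cf.
  exists d => // y yx; rewrite distrC; apply: Hd.
  by rewrite -ball_normE /= distrC.
apply/cvgrPdist_le => e /H[d d0 Hd]; apply/nbhs_ballP; exists d => //= y.
by rewrite -ball_normE /= distrC => /Hd; rewrite distrC.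
Qed.

Section ScaleProduct.
Context (R : realType) (V W : normedModType R).

Lemma scale_is_bilinear :
  bilinear_for
    (GRing.Scale.Law.clone _ _ *:%R _) (GRing.Scale.Law.clone _ _ *:%R _)
    (fun (a : R) (w : W) => a *: w).
Proof.
split=> [w|b] a x y /=; first by rewrite scalerDl scalerA.
by rewrite scalerDr !scalerA mulrC.
Qed.

(** Leibniz rule: the pair (f, g) is composed with scaling, seen as a continuous bilinear map. *)
Lemma is_diff_scale (f : V -> R) (g : V -> W) (x : V) :
  differentiable f x -> differentiable g x ->
  is_diff x (fun y => f y *: g y)
    (fun v => f x *: 'd g x v + 'd f x v *: g x).
Proof.
move=> df dg.
pose sM := bilinear_isBilinear.Build _ _ _ _ _ _ _ scale_is_bilinear.
pose s : {bilinear R -> W -> W} := HB.pack (fun (a : R) (w : W) => a *: w) sM.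
have sc : continuous (fun p : R * W => s p.1 p.2) by exact: scale_continuous.
have ds := differentiable_bilin (f x, g x) sc.
have dp := differentiable_pair df dg.
have -> : (fun y => f y *: g y) =
  (fun p : R * W => s p.1 p.2) \o (fun y => (f y, g y)) by [].
apply: DiffDef; first exact: differentiable_comp.
by rewrite diff_comp // diff_bilin // diff_pair.
Qed.

End ScaleProduct.

Section CkBasics.
Context (R : realType) (V W : normedModType R).
Implicit Types (f g : V -> W) (U : set V).

(** Openness of U makes f and g agree near each point of U, so that their derivatives agree on U
    too. *)
Lemma Ck_eq k f g U : open U -> (forall x, U x -> f x = g x) ->
  Ck k f U -> Ck k g U.
Proof.
elim: k f g => [|k IH] f g Uo fg /=.
  move=> cf x Ux; rewrite /prop_for /continuous_at -(fg x Ux).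
  apply: cvg_trans (cf x Ux); apply: near_eq_cvg.
  by apply: filterS (open_nbhs_nbhs (conj Uo Ux)) => y /fg.
have nfg x : U x -> \near x, f x = g x.
  by move=> Ux; apply: filterS (open_nbhs_nbhs (conj Uo Ux)) => y /fg.
move=> [df cf]; split=> [x Ux|v].
  by have [] := near_eq_differentiable (nfg x Ux) (df x Ux).
by apply: IH (cf v) => // x Ux; apply/near_eq_derive/nfg.
Qed.

(** [Ck] imposes conditions on the total function f at the points of the set, not on a restriction
    of f; hence O may be any set containing x. *)
Lemma Ck_local k f U :
  (forall x, U x -> exists2 O : set V, O x & Ck k f O) -> Ck k f U.
Proof.
elim: k f => [|k IH] f /= H.
  by move=> x /H[A Ax]; apply.
split=> [x /H[A Ax] []|v]; first by move=> h _; apply: h.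
by apply: IH => x /H[A Ax] [] _ h; exists A => //; exact: h.
Qed.

Lemma Ck_sub k f U O : U `<=` O -> Ck k f O -> Ck k f U.
Proof. by move=> UO fO; apply: Ck_local => x /UO; exists O. Qed.

Lemma Ck_pred k f U : Ck k.+1 f U -> Ck k f U.
Proof.
elim: k f => [|k IH] f.
  by move=> [df _] x /df /differentiable_continuous.
by move=> [df cf]; split=> // v; apply/IH/cf.
Qed.

Lemma Ck_cst k (w : W) U : Ck k (fun=> w) U.
Proof.
elim: k w => [|k IH] w /=; first by move=> x _; exact: cst_continuous.
split=> [x _|v]; first exact: differentiable_cst.
suff -> : (fun x => 'D_v (fun=> w) x) = (fun=> 0) by exact: IH.
by apply/funext => x; rewrite derive_cst.
Qed.

Lemma Ck_lin k (f : {linear V -> W}) U : continuous f -> Ck k f U.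
Proof.
case: k => [|k] cf /=; first by move=> x _; exact: cf.
split=> [x _|v]; first exact: linear_differentiable.
suff -> : (fun x => 'D_v f x) = (fun=> f v) by exact: Ck_cst.
by apply/funext => x; rewrite deriveE ?diff_lin //; exact: linear_differentiable.
Qed.

Lemma CkD k f g U : open U -> Ck k f U -> Ck k g U -> Ck k (fun x => f x + g x) U.
Proof.
move=> Uo; elim: k f g => [|k IH] f g /=.
  by move=> cf cg x Ux; apply: continuousD; [exact: cf|exact: cg].
move=> [df cf] [dg cg]; split=> [x Ux|v].
  by apply: differentiableD; [exact: df|exact: dg].
apply: (@Ck_eq _ (fun x => 'D_v f x + 'D_v g x)) => //; last exact: IH.
by move=> x Ux; rewrite deriveD //; apply: diff_derivable; [exact: df|exact: dg].
Qed.

Lemma Ck_sum k n (f : 'I_n -> V -> W) U : open U -> (forall i, Ck k (f i) U) ->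
  Ck k (fun x => \sum_i f i x) U.
Proof.
move=> Uo; elim: n f => [|n IH] f H.
  apply: Ck_eq (Ck_cst k 0 U) => // x _; by rewrite big_ord0.
apply: (@Ck_eq _ (fun x => \sum_(i < n) f (widen_ord (leqnSn n) i) x + f ord_max x)) => //.
  by move=> x _; rewrite big_ord_recr.
by apply: CkD => //; apply: IH.
Qed.

End CkBasics.

Lemma Ck_scale (R : realType) (V W : normedModType R) k (a : V -> R) (f : V -> W)
    (U : set V) : open U -> Ck k a U -> Ck k f U ->
  Ck k (fun x => a x *: f x) U.
Proof.
move=> Uo; elim: k a f => [|k IH] a f.
  by move=> ca cf x Ux; apply: continuousZ; [exact: ca|exact: cf].
move=> aS fS; move: (aS) (fS) => [da ca] [df cf]; split=> [x Ux|v].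
  by have [] := is_diff_scale (da _ Ux) (df _ Ux).
apply: (@Ck_eq _ _ _ _ (fun x => a x *: 'D_v f x + 'D_v a x *: f x)) => //.
  move=> x Ux; have [d1 d2] := is_diff_scale (da _ Ux) (df _ Ux).
  by rewrite [RHS]deriveE // d2 /= !deriveE //; [exact: da|exact: df].
apply: CkD => //; apply: IH; [exact: Ck_pred|exact: cf|exact: ca|exact: Ck_pred].
Qed.

Lemma Ck_lin_comp (R : realType) (V W Z : normedModType R) k
   (L : {linear W -> Z}) (f : V -> W) (U : set V) :
  continuous L -> open U -> Ck k f U -> Ck k (L \o f) U.
Proof.
move=> cL Uo; elim: k f => [|k IH] f.
  by move=> cf x Ux; apply: continuous_comp; [exact: cf|exact: cL].
have dL w := linear_differentiable w cL.
move=> [df cf]; split=> [x Ux|v].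
  by apply: differentiable_comp => //; exact: df.
apply: (@Ck_eq _ _ _ _ (L \o (fun x => 'D_v f x))) => //; last by apply: IH; exact: cf.
move=> x Ux /=; have dfx := df x Ux.
rewrite [RHS]deriveE; last exact: differentiable_comp.
by rewrite diff_comp ?diff_lin //= deriveE.
Qed.

(* Finite-dimensionality in a form that covers row vectors, R and their products. *)
Definition has_coords (R : realType) (W : normedModType R) : Prop :=
  exists (n : nat) (b : 'I_n -> W) (c : 'I_n -> {linear W -> R}),
    (forall i, continuous (c i)) /\ forall w, w = \sum_i c i w *: b i.

(** [Ck] controls derivatives in fixed directions only, whereas the chain rule differentiates g in
    the moving direction ['D_v f x]. Coordinates on W write this as a finite sum of derivatives of g
    along the fixed vectors b_i, with coefficients depending on x. *)
Lemma Ck_comp (R : realType) (V W Z : normedModType R) k (f : V -> W) (g : W -> Z)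
    (U : set V) (O : set W) : has_coords W -> open U -> open O ->
  (forall x, U x -> O (f x)) -> Ck k f U -> Ck k g O -> Ck k (g \o f) U.
Proof.
move=> [n [b [c [cc bc]]]] Uo Oo UO; elim: k g => [|k IH] g.
  move=> cf cg x Ux; apply: continuous_comp; first exact: cf.
  by apply: cg; exact: UO.
move=> fS; move: (fS) => [df cf] [dg cg]; split=> [x Ux|v].
  by apply: differentiable_comp; [exact: df|apply: dg; exact: UO].
apply: (@Ck_eq _ _ _ _ (fun x => \sum_i c i ('D_v f x) *: 'D_(b i) g (f x))) => //.
  move=> x Ux; have dfx := df x Ux; have dgx := dg _ (UO x Ux).
  rewrite [RHS]deriveE; last exact: differentiable_comp.
  rewrite diff_comp //=.
  transitivity ('d g (f x) (\sum_i c i ('D_v f x) *: b i)).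
    rewrite linear_sum; apply: eq_bigr => i _; rewrite linearZ /=.
    by rewrite (deriveE (b i) dgx).
  by rewrite -bc deriveE.
apply: Ck_sum => // i; apply: Ck_scale => //.
  by apply: Ck_lin_comp => //; exact: cf.
by apply: (IH ('D_(b i) g)); [exact: Ck_pred|exact: cg].
Qed.

Lemma Ck_pair (R : realType) (V W Z : normedModType R) k (f : V -> W) (g : V -> Z)
    (U : set V) : open U -> Ck k f U -> Ck k g U ->
  Ck k (fun x => (f x, g x)) U.
Proof.
move=> Uo; elim: k f g => [|k IH] f g.
  by move=> cf cg x Ux; apply: cvg_pair; [exact: cf|exact: cg].
move=> [df cf] [dg cg]; split=> [x Ux|v].
  by apply: differentiable_pair; [exact: df|exact: dg].
apply: (@Ck_eq _ _ _ _ (fun x => ('D_v f x, 'D_v g x))) => //.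
  move=> x Ux; have dfx := df x Ux; have dgx := dg x Ux.
  rewrite [RHS]deriveE; last exact: differentiable_pair.
  by rewrite diff_pair // !deriveE.
by apply: IH; [exact: cf|exact: cg].
Qed.

(** * Row vectors: coordinates and mean value inequalities *)

Section RowVectors.
Context (R : realType).

Lemma row_norm_le n (v : 'rV[R]_n) (e : R) : 0 <= e ->
  (`|v| <= e) <-> forall i, `|v ord0 i| <= e.
Proof.
move=> e0; rewrite [`|v|]/Num.Def.normr /= mx_normrE; split.
  by move=> /bigmax_leP[_ H] i; exact: (H (ord0, i)).
by move=> H; apply/bigmax_leP; split=> // -[a i] _ /=; rewrite ord1.
Qed.

Lemma row_coord_le n (v : 'rV[R]_n) i : `|v ord0 i| <= `|v|.
Proof. exact: (row_norm_le v (normr_ge0 v)).1. Qed.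

Lemma coord_is_linear n (i : 'I_n) : linear (fun v : 'rV[R]_n => v ord0 i).
Proof. by move=> a u v; rewrite !mxE. Qed.

Definition coord_fun n (i : 'I_n) : 'rV[R]_n -> R := fun v => v ord0 i.

HB.instance Definition _ n (i : 'I_n) :=
  GRing.isLinear.Build R 'rV[R]_n R _ (@coord_fun n i) (coord_is_linear i).

Lemma coord_fun_continuous n (i : 'I_n) : continuous (@coord_fun n i).
Proof. exact: coord_continuous. Qed.

Lemma rV_has_coords n : has_coords 'rV[R]_n.
Proof.
exists n, (fun i => delta_mx 0 i), (fun i => coord_fun i : {linear _ -> _}).
split; first by move=> i; exact: coord_fun_continuous.
by move=> w; rewrite {1}(row_sum_delta w).
Qed.

Lemma R_has_coords : has_coords R.
Proof.
exists 1%N, (fun=> 1), (fun=> idfun : {linear R -> R}); split.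
  by move=> i x; exact: cvg_id.
by move=> w; rewrite big_ord1 /= [_ *: _]mulr1.
Qed.

Lemma prod_has_coords (V W : normedModType R) :
  has_coords V -> has_coords W -> has_coords (V * W)%type.
Proof.
move=> [a [b [c [cc bc]]]] [a' [b' [c' [cc' bc']]]].
pose B i := match fintype.split i with inl i => (b i, 0) | inr i => (0, b' i) end : V * W.
pose C i := match fintype.split i with
  | inl i => (c i \o fst : {linear (V * W)%type -> R})
  | inr i => (c' i \o snd : {linear (V * W)%type -> R}) end
  : {linear (V * W)%type -> R}.
exists (a + a')%N, B, C; split.
  move=> i; rewrite /C; case: (fintype.split i) => j x; apply: continuous_comp.
  - exact: cvg_fst.
  - exact: cc.
  - exact: cvg_snd.
  - exact: cc'.
move=> [v w]; rewrite big_split_ord /=.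
rewrite (eq_bigr (fun i => (c i v *: b i, 0))); last first.
  move=> i _; rewrite /B /C -[lshift _ _]/(unsplit (inl i)) unsplitK /=.
  by rewrite -[LHS]/(c i v *: b i, c i v *: 0) scaler0.
rewrite [X in _ + X](eq_bigr (fun i => (0, c' i w *: b' i))); last first.
  move=> i _; rewrite /B /C -[rshift _ _]/(unsplit (inr i)) unsplitK /=.
  by rewrite -[LHS]/(c' i w *: 0, c' i w *: b' i) scaler0.
have fst_sum (I : finType) (f : I -> V * W) : (\sum_i f i).1 = \sum_i (f i).1.
  exact: (raddf_sum (fst : {linear (V * W)%type -> V})).
have snd_sum (I : finType) (f : I -> V * W) : (\sum_i f i).2 = \sum_i (f i).2.
  exact: (raddf_sum (snd : {linear (V * W)%type -> W})).
rewrite [RHS]surjective_pairing; congr pair => /=.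
  by rewrite !fst_sum /= [X in _ + X]big1 // addr0 -bc.
by rewrite !snd_sum /= big1 // add0r -bc'.
Qed.

Lemma is_derive_rowP n (u : R -> 'rV[R]_n) (t : R) (v : 'rV[R]_n) :
  is_derive t 1 u v <-> forall i, is_derive t 1 (fun s => u s ord0 i) (v ord0 i).
Proof.
split=> [[du <-] i|H].
  have := (derivable_mxP u t 1).1 du ord0 i => dui.
  by split => //; rewrite derive_mx // mxE.
have du : derivable u t 1.
  by apply/derivable_mxP => a i; rewrite ord1; have [] := H i.
split => //; rewrite derive_mx //; apply/rowP => i; rewrite mxE.
by have [_ ->] := H i.
Qed.

(** The norm is the largest coordinate, so the scalar mean value theorem can be used in each
    coordinate, with an intermediate point depending on the coordinate. *)
Lemma mean_value_le n (u du : R -> 'rV[R]_n) (a b B : R) : a <= b -> 0 <= B ->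
  (forall x, a <= x <= b -> is_derive x 1 u (du x)) ->
  (forall x, a <= x <= b -> `|du x| <= B) ->
  `|u b - u a| <= B * (b - a).
Proof.
move=> ab B0 hu hB; apply/row_norm_le => [|i].
  by rewrite mulr_ge0 // subr_ge0.
have [x xab E] : exists2 x, x \in `[a, b]%R &
    u b ord0 i - u a ord0 i = du x ord0 i * (b - a).
  apply: (@MVT_segment _ (fun s => u s ord0 i) (fun s => du s ord0 i)) => //.
    move=> x; rewrite in_itv /= => /andP[ax xb].
    have /is_derive_rowP/(_ i) // : is_derive x 1 u (du x).
    by apply: hu; rewrite !ltW.
  apply: derivable_within_continuous => x; rewrite in_itv /= => xab.
  by have /is_derive_rowP/(_ i)[] := hu x xab.
rewrite !mxE E normrM (ger0_norm (_ : 0 <= b - a)) ?subr_ge0 //.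
apply: ler_wpM2r; first by rewrite subr_ge0.
apply: le_trans (row_coord_le _ _) _; apply: hB.
by move: xab; rewrite in_itv.
Qed.

Lemma mean_value_norm_le n (u du : R -> 'rV[R]_n) (a b B : R) : 0 <= B ->
  (forall x, Num.min a b <= x <= Num.max a b -> is_derive x 1 u (du x)) ->
  (forall x, Num.min a b <= x <= Num.max a b -> `|du x| <= B) ->
  `|u b - u a| <= B * `|b - a|.
Proof.
move=> B0 hu hB; case: (leP a b) => [ab|/ltW ba].
  move: hu hB; rewrite (min_l ab) (max_r ab) => hu hB.
  rewrite (ger0_norm (_ : 0 <= b - a)) ?subr_ge0 //.
  exact: (mean_value_le ab B0 hu hB).
move: hu hB; rewrite (min_r ba) (max_l ba) => hu hB.
rewrite distrC [`|b - a|]distrC (ger0_norm (_ : 0 <= a - b)) ?subr_ge0 //.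
exact: (mean_value_le ba B0 hu hB).
Qed.

End RowVectors.

(** * Ordinary differential equations *)

Lemma is_derive_diff_comp (R : realType) (V W : normedModType R) (u : R -> V)
    (F : V -> W) (t : R) (v : V) :
  is_derive t 1 u v -> differentiable F (u t) ->
  is_derive t 1 (F \o u) ('d F (u t) v).
Proof.
move=> [/derivable1_diffP du <-] dF.
have dFu : differentiable (F \o u) t by exact: differentiable_comp.
split; first exact/derivable1_diffP.
by rewrite deriveE // diff_comp //= (deriveE _ du).
Qed.

Lemma is_derive_line (R : realType) (V : normedModType R) (w v : V) (s : R) :
  is_derive s 1 (fun s => w + s *: v) v.
Proof.
have ds : differentiable (fun s : R => s *: v) s by exact: differentiableZl.
have := is_deriveD (is_derive_cst w s 1) (derivableP (diff_derivable ds)).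
by rewrite add0r (deriveE _ ds) diffZl // diff_val /= scale1r.
Qed.

(** The partial derivatives are bounded by C near u0. A ball is convex, so the mean value inequality
    along segments gives the Lipschitz constant a C. *)
Lemma C1_locally_lipschitz (R : realType) a b (F : 'rV[R]_a -> 'rV[R]_b)
    (U : set 'rV[R]_a) (u0 : 'rV[R]_a) : open U -> U u0 -> Ck 1 F U ->
  exists r L : R, [/\ 0 < r, 0 <= L, forall u, `|u - u0| <= r -> U u &
    forall u w, `|u - u0| <= r -> `|w - u0| <= r -> `|F u - F w| <= L * `|u - w|].
Proof.
move=> Uo Uu0 [dF cF].
pose e i : 'rV[R]_a := delta_mx 0 i.
(* The [+ 1] leaves room for the variation of the partial derivatives near u0. *)
pose C := \sum_i `|'D_(e i) F u0| + 1.
have C0 : 0 <= C by rewrite addr_ge0 // sumr_ge0.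
have near_C : \forall y \near u0, U y /\ forall i, `|'D_(e i) F y| <= C.
  suff : \forall y \near u0, forall i, `|'D_(e i) F y| <= C.
    apply: filterS2 (open_nbhs_nbhs (conj Uo Uu0)); by split.
  have FF := @filter_forall 'rV[R]_a 'I_a (fun i y => `|'D_(e i) F y| <= C) (nbhs u0) _.
  apply: FF => i.
  have /cvgrPdist_le /(_ 1 ltr01) := cF (e i) u0 Uu0.
  apply: filterS => y Hy.
  rewrite -['D_(e i) F y](subrK ('D_(e i) F u0)) (le_trans (ler_normD _ _)) //.
  rewrite addrC distrC lerD // (bigD1 i) //= lerDl; exact: sumr_ge0.
have [r0 /= r0_gt0 Hr] : exists2 r : R, 0 < r & forall y, `|y - u0| < r ->
    U y /\ forall i, `|'D_(e i) F y| <= C.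
  move/nbhs_ballP: near_C => [r /= r_gt0 H]; exists r => // y yr.
  by apply: H; rewrite -ball_normE /= distrC.
have {}Hr y : `|y - u0| <= r0 / 2 -> U y /\ forall i, `|'D_(e i) F y| <= C.
  by move=> yr; apply: Hr; apply: le_lt_trans yr _; lra.
exists (r0 / 2), (a%:R * C); split.
- by rewrite divr_gt0.
- by rewrite mulr_ge0.
- by move=> u /Hr[].
move=> u w ur wr.
pose y s := w + s *: (u - w).
have yr s : 0 <= s <= 1 -> `|y s - u0| <= r0 / 2.
  move=> /andP[s0 s1].
  have -> : y s - u0 = (1 - s) *: (w - u0) + s *: (u - u0).
    by rewrite /y scalerBl scale1r !scalerBr; apply/rowP => i; rewrite !mxE; ring.
  rewrite (le_trans (ler_normD _ _)) // !normrZ (ger0_norm s0).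
  rewrite (ger0_norm (_ : 0 <= 1 - s)) ?subr_ge0 //.
  have : (1 - s) * `|w - u0| <= (1 - s) * (r0 / 2) by rewrite ler_wpM2l ?subr_ge0.
  have : s * `|u - u0| <= s * (r0 / 2) by rewrite ler_wpM2l.
  by lra.
have -> : F u - F w = (F \o y) 1 - (F \o y) 0.
  by rewrite /= /y scale1r scale0r addr0 subrKC.
rewrite -[leRHS]mulr1 -[X in _ * X](subr0 (1 : R)).
apply: (@mean_value_le _ _ _ (fun s => 'd F (y s) (u - w))) => //.
- by rewrite mulr_ge0 // mulr_ge0.
- move=> s /yr/Hr[Uy _]; apply: is_derive_diff_comp; first exact: is_derive_line.
  exact: dF.
- move=> s /yr/Hr[Uy Dy].
  rewrite {1}(row_sum_delta (u - w)) linear_sum.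
  apply: le_trans (ler_norm_sum _ _ _) _.
  have -> : a%:R * C * `|u - w| = \sum_(i < a) C * `|u - w|.
    by rewrite sumr_const card_ord -mulrA mulr_natl.
  apply: ler_sum => i _.
  rewrite linearZ /= normrZ mulrC; apply: ler_pM => //; last exact: row_coord_le.
  by rewrite -deriveE; [exact: Dy|exact: dF].
Qed.

(** Integrating from -1 puts 0 in the interior of the range where the fundamental theorem applies;
    the Picard iteration only uses times in (-1, 1). *)
Lemma primitive_ex (R : realType) (h : R -> R) : continuous h ->
  exists P : R -> R, P 0 = 0 /\ forall t : R, -1 < t -> is_derive t 1 P (h t).
Proof.
move=> ch.
pose F y := (\int[@lebesgue_measure R]_(t in `[(-1 : R), y]) h t)%R.
exists (fun y => F y - F 0); split; first by rewrite subrr.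
move=> t t1.
have [dF F't] : derivable F t 1 /\ derive1 F t = h t.
  apply: (@continuous_FTC1_closed _ h (-1) t (t + 1)) => //; last exact: ch.
  - by rewrite ltrDl.
  - apply: continuous_compact_integrable; first exact: segment_compact.
    by apply: continuous_subspaceT => x; exact: ch.
have dF' : is_derive t 1 F (h t) by split => //; rewrite -derive1E.
have := is_deriveB dF' (is_derive_cst (F 0) t 1); by rewrite subr0.
Qed.

Lemma row_primitive_ex (R : realType) n (h : R -> 'rV[R]_n) : continuous h ->
  exists P : R -> 'rV[R]_n, P 0 = 0 /\ forall t : R, -1 < t -> is_derive t 1 P (h t).
Proof.
move=> ch.
have /choice[P HP] i : exists P : R -> R, P 0 = 0 /\
    forall t : R, -1 < t -> is_derive t 1 P (h t ord0 i).
  apply: (@primitive_ex R (fun t => h t ord0 i)) => t.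
  apply: (@continuous_comp _ _ _ h (fun v : 'rV[R]_n => v ord0 i)); first exact: ch.
  exact: coord_continuous.
exists (fun t => \row_i P i t); split.
  by apply/rowP => i; rewrite !mxE; have [] := HP i.
move=> t t1; apply/is_derive_rowP => i.
have [_ /(_ t t1)] := HP i.
by congr is_derive; apply/funext => s; rewrite mxE.
Qed.

Lemma half_pow_lt (R : realType) (C e : R) : 0 < e -> exists k, C / 2 ^+ k < e.
Proof.
move=> e0; have /cvgrPdist_lt /(_ e e0) [k _ /(_ k (leqnn k))] :
    (fun k => C / 2 ^+ k) @ \oo --> (0 : R).
  rewrite -(mulr0 C); apply: cvgMr.
  rewrite (_ : (fun k => _) = (fun k => 2^-1 ^+ k)).
    by apply: cvg_expr; rewrite ger0_norm ?invr_ge0 // invf_lt1 // ltr1n.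
  by apply/funext => k; rewrite exprVn.
by rewrite sub0r normrN /= => /(le_lt_trans (ler_norm _)); exists k.
Qed.

Lemma geometric_cvg (R : realType) n (u : nat -> 'rV[R]_n) (B : R) :
  (forall k, `|u k.+1 - u k| <= B / 2 ^+ k) ->
  exists l, forall k, `|l - u k| <= 2 * B / 2 ^+ k.
Proof.
move=> Hu.
have B0 : 0 <= B by have := Hu 0%N; rewrite expr0 divr1; apply: le_trans.
have p2 k : 0 < 2 ^+ k :> R by rewrite exprn_gt0.
(* The subtracted term, the tail of the geometric series, is what lets the induction on p close. *)
have H k p : `|u (k + p)%N - u k| <= 2 * B / 2 ^+ k - 2 * B / 2 ^+ (k + p).
  elim: p => [|p IH]; first by rewrite addn0 !subrr normr0.
  rewrite addnS -(subrK (u (k + p)%N) (u (k + p).+1)) -addrA.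
  apply: le_trans (ler_normD _ _) _.
  have -> : 2 * B / 2 ^+ (k + p).+1 = 2 * B / 2 ^+ (k + p) - B / 2 ^+ (k + p).
    by rewrite exprS invfM; have := p2 (k + p)%N; move: (2 ^+ _) => c c0; field;
      rewrite gt_eqF.
  have := Hu (k + p)%N; move: IH; lra.
have {}H k p : `|u (k + p)%N - u k| <= 2 * B / 2 ^+ k.
  apply: le_trans (H k p) _; rewrite gerBl.
  by apply: divr_ge0; [rewrite mulr_ge0|exact: ltW].
have cu : cvgn u.
  apply/cauchy_cvgP/cauchy_exP => e e0.
  have [k Hk] := half_pow_lt (2 * B) e0.
  exists (u k); exists k => // p /= kp; rewrite -ball_normE /= distrC.
  by rewrite -(subnKC kp); exact: le_lt_trans (H k _) Hk.
exists (limn u) => k.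
have : (fun p => `|u p - u k|) @ \oo --> `|limn u - u k|.
  by apply: cvg_norm; apply: cvgB; [exact: cu|exact: cvg_cst].
move=> H'; apply: (closed_cvg _ (@closed_le R _) _ _ H').
by exists k => // p /= kp; rewrite -(subnKC kp); exact: H.
Qed.

Section Picard.
Context (R : realType) (n : nat).

(** Its values at times t <= -1 are unconstrained, so it is only evaluated at times clamped to some
    [-d, d] with d < 1, or near such times. *)
Definition primitive0 (h : R -> 'rV[R]_n) : R -> 'rV[R]_n :=
  xget (fun=> 0)
    [set P | P 0 = 0 /\ forall t : R, -1 < t -> is_derive t 1 P (h t)].

Lemma primitive0P (h : R -> 'rV[R]_n) : continuous h ->
  primitive0 h 0 = 0 /\ forall t : R, -1 < t -> is_derive t 1 (primitive0 h) (h t).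
Proof.
move=> ch; have [P HP] := row_primitive_ex ch.
by rewrite /primitive0; case: xgetP => [//|/(_ P)].
Qed.

Definition clamp (a x : R) : R := Num.max (- a) (Num.min a x).

Lemma clamp_norm_le (a x : R) : 0 <= a -> `|clamp a x| <= a.
Proof.
move=> a0; rewrite ler_norml /clamp le_max lexx /= ge_max ge_min lexx /=.
by rewrite andbT; lra.
Qed.

Lemma clamp_id (a x : R) : `|x| <= a -> clamp a x = x.
Proof.
by rewrite ler_norml /clamp => /andP[h1 h2]; rewrite min_r // max_r.
Qed.

Lemma clamp_continuous (a : R) : continuous (clamp a).
Proof.
move=> x; apply: (@continuous_max _ _ (fun=> - a)); first exact: cst_continuous.
by apply: (@continuous_min _ _ (fun=> a)); [exact: cst_continuous|exact: cvg_id].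
Qed.

Lemma clamp_lip (a x y : R) : `|clamp a x - clamp a y| <= `|x - y|.
Proof.
rewrite /clamp.
have : x - y <= `|x - y| /\ y - x <= `|x - y|.
  by split; [exact: ler_norm|rewrite distrC; exact: ler_norm].
move=> [h1 h2]; rewrite ler_norml.
by case: (leP a x) => ?; case: (leP a y) => ?; case: (leP (- a) a) => ?;
  case: (leP (- a) x) => ?; case: (leP (- a) y) => ?; lra.
Qed.

Lemma antiderivative_clamp_le (u du : R -> 'rV[R]_n) (B d t : R) :
  u 0 = 0 -> (forall t : R, -1 < t -> is_derive t 1 u (du t)) ->
  0 <= d < 1 -> 0 <= B -> (forall t, `|du t| <= B) ->
  `|u (clamp d t)| <= B * d.
Proof.
move=> u0 hu /andP[d0 d1] B0 hB.
rewrite -(subr0 (u _)) -u0.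
have ct := clamp_norm_le t d0.
apply: (@le_trans _ _ (B * `|clamp d t - 0|)); last first.
  by rewrite subr0 ler_wpM2l.
have cl : - d <= clamp d t by move: ct; rewrite ler_norml => /andP[].
apply: (@mean_value_norm_le _ _ _ du) => // x /andP[x1 _].
apply: hu; apply: lt_le_trans x1; rewrite lt_min; apply/andP; split; lra.
Qed.

Lemma primitive0_diff_le (g h : R -> 'rV[R]_n) (B d t : R) : continuous g ->
  continuous h -> 0 <= d < 1 -> 0 <= B -> (forall t, `|g t - h t| <= B) ->
  `|primitive0 g (clamp d t) - primitive0 h (clamp d t)| <= B * d.
Proof.
move=> cg ch d01 B0 gh.
have [g0 dg] := primitive0P cg; have [h0 dh] := primitive0P ch.
apply: (@antiderivative_clamp_le (primitive0 g - primitive0 h) (fun t => g t - h t)) => //.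
  by rewrite !fctE g0 h0 subrr.
by move=> s s1; exact: is_deriveB (dg s s1) (dh s s1).
Qed.

Lemma primitive0_clamp_continuous (h : R -> 'rV[R]_n) (d : R) : continuous h ->
  0 <= d < 1 -> continuous (fun t => primitive0 h (clamp d t)).
Proof.
move=> ch /andP[d0 d1] t.
apply: (@continuous_comp _ _ _ (clamp d)); first exact: clamp_continuous.
apply/differentiable_continuous/derivable1_diffP.
have [_ dh] := primitive0P ch.
have [] // := dh (clamp d t) _.
by have := clamp_norm_le t d0; rewrite ler_norml => /andP[]; lra.
Qed.

(** [step] halves uniform distances between continuous curves. Its iterates from the constant curve
    converge geometrically, uniformly in time, and the limit is a fixed point. *)
Lemma picard_lipschitz (F : 'rV[R]_n -> 'rV[R]_n) (L : R) (u0 : 'rV[R]_n) :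
  (forall u w, `|F u - F w| <= L * `|u - w|) ->
  exists (d : R) (u : R -> 'rV[R]_n), [/\ 0 < d, u 0 = u0 &
    forall t : R, `|t| < d -> is_derive t 1 u (F (u t))].
Proof.
move=> FL.
wlog L0 : L FL / 0 <= L.
  move=> /(_ (Num.max 0 L)); apply; last by rewrite le_max lexx.
  move=> u w; apply: le_trans (FL u w) _.
  by rewrite ler_wpM2r // le_max lexx orbT.
have cF : continuous F.
  move=> u; apply/continuous_at_normP => e e0.
  have L1 : 0 < L + 1 by rewrite ltr_wpDl.
  exists (e / (L + 1)); first by rewrite divr_gt0.
  move=> w; rewrite ltr_pdivlMr // => h.
  apply: le_trans (FL w u) _.
  by move: h (normr_ge0 (w - u)); nra.
(* This makes L d at most 1/2, the contraction factor, and the [+ 1] keeps d below 1 even when L =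
   0. *)
pose d := (2 * (L + 1))^-1.
have d0 : 0 < d by rewrite invr_gt0 mulr_gt0 // ltr_wpDl.
have dL : L * d <= 1 / 2.
  rewrite /d ler_pdivrMr; last by rewrite mulr_gt0 // ltr_wpDl.
  by lra.
have d1 : d < 1.
  rewrite /d invf_lt1; last by rewrite mulr_gt0 // ltr_wpDl.
  by lra.
have d01 : 0 <= d < 1 by rewrite ltW.
(* Clamping the time to [-d, d] makes all estimates hold on the whole line. *)
pose step (p : R -> 'rV[R]_n) t := u0 + primitive0 (F \o p) (clamp d t).
have cFp (p : R -> 'rV[R]_n) : continuous p -> continuous (F \o p).
  by move=> cp t; apply: continuous_comp; [exact: cp|exact: cF].
have cstep (p : R -> 'rV[R]_n) : continuous p -> continuous (step p).
  move=> cp t; apply: cvgD; first exact: cvg_cst.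
  by apply: primitive0_clamp_continuous => //; exact: cFp.
have step_le (p q : R -> 'rV[R]_n) B : continuous p -> continuous q -> 0 <= B ->
    (forall t, `|p t - q t| <= B) -> forall t, `|step p t - step q t| <= B / 2.
  move=> cp cq B0 pq t.
  rewrite /step opprD addrACA subrr add0r.
  apply: le_trans (primitive0_diff_le t (cFp p cp) (cFp q cq) d01 (B := L * B) _ _) _.
  - exact: mulr_ge0.
  - by move=> s /=; apply: le_trans (FL _ _) _; rewrite ler_wpM2l.
  - by move: dL B0; nra.
pose phi k := iter k step (fun=> u0).
have cphi k : continuous (phi k).
  by elim: k => [|k IH]; [exact: cst_continuous|exact: cstep].
pose B0 := `|F u0| * d.
have B00 : 0 <= B0 by rewrite mulr_ge0 // ltW.
have phi_step k t : `|phi k.+1 t - phi k t| <= B0 / 2 ^+ k.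
  elim: k t => [|k IH] t.
    rewrite expr0 divr1 /= /step addrC addKr.
    have cF0 : continuous (F \o (fun _ : R => u0)) by apply: cFp; exact: cst_continuous.
    have [p0 dp] := primitive0P cF0.
    by apply: antiderivative_clamp_le dp _ _ _.
  rewrite exprS invfM (mulrC 2^-1) mulrA.
  apply: (step_le (phi k.+1) (phi k) _ (cphi k.+1) (cphi k) _ IH t).
  by rewrite divr_ge0 // exprn_ge0.
have /choice[l Hl] t : exists l, forall k, `|l - phi k t| <= 2 * B0 / 2 ^+ k.
  by apply: geometric_cvg => k; exact: phi_step.
have cl : continuous l.
  move=> t; apply/continuous_at_normP => e e0.
  have e30 : 0 < e / 3 by rewrite divr_gt0.
  have [k Hk] := half_pow_lt (2 * B0) e30.
  have /continuous_at_normP /(_ _ e30)[r r0 Hr] := cphi k t.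
  exists r => // s /Hr Hs.
  have h1 := le_trans (Hl t k) (ltW Hk); have h2 := le_trans (Hl s k) (ltW Hk).
  have -> : l s - l t = (l s - phi k s) + ((phi k s - phi k t) + (phi k t - l t)).
    by rewrite addrA subrKA addrA subrK.
  apply: le_trans (ler_normD _ _) _.
  apply: le_trans (lerD (lexx _) (ler_normD _ _)) _.
  by rewrite (distrC (phi k t)); move: h1 h2 Hs => /=; lra.
(* For every k, both sides are within 2 B0 / 2^(k+1) of the iterate [phi k.+1 t]. *)
have l_fix t : l t = step l t.
  apply/eqP; rewrite -subr_eq0 -normr_le0 leNgt; apply/negP => H.
  have [k Hk] := half_pow_lt (2 * B0) H.
  have Bk0 : 0 <= 2 * B0 / 2 ^+ k.
    by apply: divr_ge0; [exact: mulr_ge0|exact: exprn_ge0].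
  have h1 := Hl t k.+1.
  move: Hk; rewrite ltNge => /negP; apply.
  rewrite -(subrK (phi k.+1 t) (l t)) -addrA.
  apply: le_trans (ler_normD _ _) _.
  have h2 : `|phi k.+1 t - step l t| <= 2 * B0 / 2 ^+ k / 2.
    by apply: step_le => // s; rewrite distrC; exact: Hl.
  have e : 2 * B0 / 2 ^+ k.+1 = 2 * B0 / 2 ^+ k / 2 by rewrite exprS invfM (mulrC 2^-1) mulrA.
  by move: h1 h2; rewrite e; lra.
have [p0 dp] := primitive0P (cFp l cl).
exists d, l; split => //.
  by rewrite l_fix /step clamp_id ?normr0 ?ltW // p0 addr0.
move=> t td.
have t1 : -1 < t by move: td; rewrite ltr_norml => /andP[]; lra.
apply: (@near_eq_is_derive _ _ _ (fun s => u0 + primitive0 (F \o l) s)).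
  have : \forall s \near t, `|s| < d.
    have := @cvgr_norm_lt _ _ _ _ _ id t (@cvg_id _ _) d td; exact.
  by apply: filterS => s sd; rewrite [RHS]l_fix /step clamp_id // ltW.
have := is_deriveD (is_derive_cst u0 t 1) (dp t t1).
by rewrite add0r.
Qed.

End Picard.

Lemma picard_C1 (R : realType) n (F : 'rV[R]_n -> 'rV[R]_n) (U : set 'rV[R]_n)
    (u0 : 'rV[R]_n) : open U -> U u0 -> Ck 1 F U ->
  exists (d : R) (u : R -> 'rV[R]_n), [/\ 0 < d, u 0 = u0 &
    forall t : R, `|t| < d -> U (u t) /\ is_derive t 1 u (F (u t))].
Proof.
move=> Uo Uu0 F1.
have [r [L [r0 L0 rU FL]]] := C1_locally_lipschitz Uo Uu0 F1.
(* Projecting onto a box around u0 makes F globally Lipschitz. *)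
pose cl (w : 'rV[R]_n) := u0 + \row_i clamp r ((w - u0) ord0 i).
have clr w : `|cl w - u0| <= r.
  rewrite /cl addrC addKr; apply/row_norm_le; first exact: ltW.
  by move=> i; rewrite mxE; apply/clamp_norm_le/ltW.
have cl_id w : `|w - u0| <= r -> cl w = w.
  move=> /(row_norm_le _ (ltW r0)) H; rewrite /cl -[RHS](subrK u0) addrC.
  congr (_ + _); apply/rowP => i; rewrite mxE clamp_id //; exact: H.
have FclL u w : `|(F \o cl) u - (F \o cl) w| <= L * `|u - w|.
  apply: le_trans (FL _ _ (clr _) (clr _)) _; rewrite ler_wpM2l //.
  apply/row_norm_le => // i.
  have -> : (cl u - cl w) ord0 i =
      clamp r ((u - u0) ord0 i) - clamp r ((w - u0) ord0 i).
    by rewrite !mxE; ring.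
  apply: le_trans (clamp_lip _ _ _) _.
  have -> : (u - u0) ord0 i - (w - u0) ord0 i = (u - w) ord0 i.
    by rewrite !mxE; ring.
  exact: row_coord_le.
have [d [u [d0 u00 Hu]]] := picard_lipschitz u0 FclL.
have cu : {for 0, continuous u}.
  apply/differentiable_continuous/derivable1_diffP.
  by have [] // := Hu 0 _; rewrite normr0.
(* For times below d' the solution stays in the box, where the projected field is F itself. *)
have [d' d'0 Hd'] := (continuous_at_normP u 0).1 cu r r0.
exists (Num.min d d'), u; split => //; first by rewrite lt_min d0.
move=> t; rewrite lt_min => /andP[td td'].
have ur : `|u t - u0| <= r by rewrite -u00; apply: Hd'; rewrite subr0.
by split; [exact: rU|have := Hu t td; rewrite /= cl_id].
Qed.

(** An iteration takes the place of Gronwall's inequality. On an interval of radius d with L d <=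
    1/2 where both curves stay in the Lipschitz ball, any bound on |y - z| is halved by the mean
    value inequality; starting from 2 r, the gap is at most 2 r / 2^k for every k. *)
Lemma ode_locally_unique (R : realType) n (F : 'rV[R]_n -> 'rV[R]_n)
    (U : set 'rV[R]_n) (y z : R -> 'rV[R]_n) (t0 : R) :
  open U -> U (y t0) -> Ck 1 F U -> y t0 = z t0 ->
  (\forall t \near t0, is_derive (t : R) 1 y (F (y t))) ->
  (\forall t \near t0, is_derive (t : R) 1 z (F (z t))) ->
  \forall t \near t0, y t = z t.
Proof.
move=> Uo Uu0 F1 yz hy hz.
have [r [L [r0 L0 rU FL]]] := C1_locally_lipschitz Uo Uu0 F1.
have near_r (x : R -> 'rV[R]_n) : x t0 = y t0 ->
    (\forall t \near t0, is_derive (t : R) 1 x (F (x t))) ->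
    \forall t \near t0, `|x t - y t0| <= r.
  move=> <- hx; have /derivable1_diffP /differentiable_continuous cx :
    derivable x t0 1 by have [] := nbhs_singleton hx.
  have [d d0 Hd] := (continuous_at_normP x t0).1 cx r r0.
  by apply/nbhs_ballP; exists d => // t; rewrite -ball_normE /= distrC; exact: Hd.
have [d [d0 dL Hd]] : exists d : R, [/\ 0 < d, L * d <= 1 / 2 & forall t : R, `|t - t0| < d ->
    [/\ is_derive (t : R) 1 y (F (y t)), is_derive t 1 z (F (z t)),
        `|y t - y t0| <= r & `|z t - y t0| <= r]].
  have /nbhs_ballP[d0 /= d00 Hd0] : \forall t \near t0,
    [/\ is_derive (t : R) 1 y (F (y t)), is_derive t 1 z (F (z t)),
        `|y t - y t0| <= r & `|z t - y t0| <= r].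
    have h1 := near_r y erefl hy; have h2 := near_r z (esym yz) hz.
    near=> t; split; near: t => //.
  have L1 : 0 < 2 * (L + 1) by rewrite mulr_gt0 // ltr_wpDl.
  exists (Num.min d0 (2 * (L + 1))^-1); split.
  - by rewrite lt_min d00 invr_gt0.
  - apply: (@le_trans _ _ (L * (2 * (L + 1))^-1)).
      by rewrite ler_wpM2l // ge_min lexx orbT.
    by rewrite ler_pdivrMr //; lra.
  - move=> t; rewrite lt_min => /andP[h _]; apply: Hd0.
    by rewrite -ball_normE /= distrC.
apply/nbhs_ballP; exists d => // t; rewrite -ball_normE /= distrC => td.
have H k : forall t : R, `|t - t0| < d -> `|y t - z t| <= (2 * r) / 2 ^+ k.
  elim: k => [|k IH] s sd.
    rewrite expr0 divr1 -(subrKA (y t0)).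
    have [_ _ h1 h2] := Hd s sd; apply: le_trans (ler_normD _ _) _.
    by rewrite (distrC (y t0)); lra.
  have B0 : 0 <= 2 * r / 2 ^+ k.
    by apply: divr_ge0; [apply: mulr_ge0 => //; exact: ltW|exact: exprn_ge0].
  have -> : y s - z s = (y - z) s - (y - z) t0 by rewrite !fctE yz subrr subr0.
  have btw x : Num.min t0 s <= x <= Num.max t0 s -> `|x - t0| < d.
    move: sd; rewrite ltr_norml ltr_norml.
    by case: (leP t0 s) => ? /andP[? ?] /andP[? ?]; apply/andP; split; lra.
  apply: le_trans (mean_value_norm_le (du := fun t => F (y t) - F (z t))
    (B := L * (2 * r / 2 ^+ k)) _ _ _) _.
  - exact: mulr_ge0.
  - by move=> x /btw xd; have [h1 h2 _ _] := Hd x xd; exact: is_deriveB.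
  - move=> x /btw xd; have [_ _ h1 h2] := Hd x xd.
    by apply: le_trans (FL _ _ h1 h2) _; rewrite ler_wpM2l // IH.
  - have -> : 2 * r / 2 ^+ k.+1 = 2 * r / 2 ^+ k / 2 by rewrite exprS invfM (mulrC 2^-1) mulrA.
    have h := le_trans (ler_wpM2l L0 (ltW sd)) dL.
    rewrite -subr_ge0; move: h B0; set q := 2 * r / 2 ^+ k; set a := `|s - t0|.
    rewrite -subr_ge0 => h B0; have := mulr_ge0 B0 h; lra.
apply/eqP; rewrite -subr_eq0 -normr_le0 leNgt; apply/negP => h.
have [k Hk] := half_pow_lt (2 * r) h.
by have := le_lt_trans (H k t td) Hk; rewrite ltxx.
Unshelve. all: by end_near. Qed.

(** * Curves and smooth maps on manifolds *)

Section Charts.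
Context (R : realType) (n : nat) (M : topologicalType).
Implicit Types (c : chart R n M) (p : M) (u : 'rV[R]_n).

Lemma chart_inv_cont c u : chart_cod c u -> {for u, continuous (chart_inv c)}.
Proof.
move=> cu; have := @chart_inv_continuous _ _ _ c.
by rewrite continuous_open_subspace; [apply; rewrite inE|exact: chart_cod_open].
Qed.

Lemma chart_cod_map c p : chart_dom c p -> chart_cod c (chart_map c p).
Proof. by move=> cp; exists p. Qed.

Lemma chart_inv_dom c u : chart_cod c u -> chart_dom c (chart_inv c u).
Proof. by move=> [p cp <-]; rewrite chart_mapK. Qed.

Lemma chart_invK c u : chart_cod c u -> chart_map c (chart_inv c u) = u.
Proof. by move=> [p cp <-]; rewrite chart_mapK. Qed.

Lemma chart_dom_nbhs c p : chart_dom c p -> nbhs p (chart_dom c).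
Proof. by move=> cp; exact: open_nbhs_nbhs (conj (chart_dom_open c) cp). Qed.

Lemma chart_cod_nbhs c u : chart_cod c u -> nbhs u (chart_cod c).
Proof. by move=> cu; apply: open_nbhs_nbhs; split => //; exact: chart_cod_open. Qed.

Lemma chart_map_image c (U : set M) :
  chart_map c @` (chart_dom c `&` U) = chart_cod c `&` chart_inv c @^-1` U.
Proof.
apply/seteqP; split=> [_ [p [cp Up] <-]|_ [[p cp <-]]] /=.
  by rewrite chart_mapK //; split => //; exact: chart_cod_map.
by rewrite chart_mapK // => Up; exists p.
Qed.

End Charts.

Lemma open_preimageI (T S : topologicalType) (D : set T) (f : T -> S) (U : set S) :
  open D -> (forall x, D x -> {for x, continuous f}) -> open U ->
  open (D `&` f @^-1` U).
Proof.
move=> Do cf Uo; rewrite openE => x [Dx Ufx]; apply: filterI.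
  exact: open_nbhs_nbhs.
exact: (cf x Dx) (open_nbhs_nbhs (conj Uo Ufx)).
Qed.

Lemma chart_map_image_open (R : realType) n (M : topologicalType)
    (c : chart R n M) (U : set M) :
  open U -> open (chart_map c @` (chart_dom c `&` U)).
Proof.
move=> Uo; rewrite chart_map_image; apply: open_preimageI => //.
  exact: chart_cod_open.
exact: chart_inv_cont.
Qed.

Section CurvesInCharts.
Context (R : realType) (n : nat) (M : manifoldType R n).

Lemma curve_near_chart (c : chart R n M) (g : R -> M) (t : R) :
  {for t, continuous g} -> chart_dom c (g t) ->
  \forall s \near t, chart_dom c (g s).
Proof. by move=> cg /chart_dom_nbhs; exact: cg. Qed.

Lemma has_velocity_cont (g : R -> M) t v :
  has_velocity g t v -> {for t, continuous g}.
Proof. by case. Qed.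

Lemma velocityE (g : R -> M) t v : has_velocity g t v -> velocity g t = v.
Proof. by move=> [_ [_ <-]]. Qed.

Lemma velocity_unique (g : R -> M) t v w :
  has_velocity g t v -> has_velocity g t w -> v = w.
Proof. by move=> /velocityE <- /velocityE <-. Qed.

Lemma near_eq_has_velocity (g h : R -> M) t v :
  (\forall s \near t, g s = h s) -> has_velocity g t v -> has_velocity h t v.
Proof.
move=> gh [cg dg]; have gt := nbhs_singleton gh.
split.
  rewrite /prop_for /continuous_at -gt.
  by apply: cvg_trans cg; exact: near_eq_cvg.
rewrite -gt; apply: near_eq_is_derive dg.
by apply: filterS gh => s /= ->.
Qed.

Lemma has_velocity_cst (p : M) t : has_velocity (fun=> p) t (0 : 'rV[R]_n).
Proof. split; [exact: cst_continuous|exact: is_derive_cst]. Qed.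

Lemma has_velocity_affine (g : R -> M) (a b t : R) v :
  has_velocity g (a + t * b) v -> has_velocity (fun s => g (a + s * b)) t (b *: v).
Proof.
move=> [cg dg].
have dl := is_derive_line a b t.
have cl : {for t, continuous (fun s : R => a + s * b)}.
  by apply/differentiable_continuous/derivable1_diffP; have [] := dl.
split; first exact: (continuous_comp cl cg).
have dg' : differentiable (chart_map (chart_at (g (a + t * b))) \o g) (a + t * b).
  by apply/derivable1_diffP; have [] := dg.
have := is_derive_diff_comp dl dg'; congr is_derive.
have [_ <-] := dg; rewrite (deriveE _ dg') -linearZ.
by congr ('d _ _ _); exact: esym (mulr1 b).
Qed.

Lemma has_velocity_addl (g : R -> M) (a t : R) v :
  has_velocity g (a + t) v -> has_velocity (fun s => g (a + s)) t v.
Proof.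
move=> H; have := @has_velocity_affine g a 1 t v; rewrite mulr1 scale1r => /(_ H).
by congr has_velocity; apply/funext => s; rewrite mulr1.
Qed.

Lemma has_velocity_shift (g : R -> M) (a : R) v :
  has_velocity (fun s => g (a + s)) 0 v <-> has_velocity g a v.
Proof.
split=> [H|H].
  have := @has_velocity_addl (fun s => g (a + s)) (- a) a v.
  rewrite addNr => /(_ H).
  by congr has_velocity; apply/funext => s; rewrite addNKr.
by apply: has_velocity_addl; rewrite addr0.
Qed.

Lemma chart_line_velocity (p : M) (v : 'rV[R]_n) :
  let c := chart_at p in
  has_velocity (fun s : R => chart_inv c (chart_map c p + s *: v)) 0 v.
Proof.
move=> c; have cp : chart_dom c p by exact: chart_at_dom.
have dl := is_derive_line (chart_map c p) v 0.
have cl : {for 0, continuous (fun s : R => chart_map c p + s *: v)}.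
  by apply/differentiable_continuous/derivable1_diffP; have [] := dl.
have l0 : chart_map c p + (0 : R) *: v = chart_map c p by rewrite scale0r addr0.
have cod0 : chart_cod c (chart_map c p + (0 : R) *: v).
  by rewrite l0; exact: chart_cod_map.
split.
  exact: (continuous_comp cl (chart_inv_cont cod0)).
rewrite l0 chart_mapK // -/c; apply: near_eq_is_derive dl.
have H : \forall s \near (0 : R), chart_cod c (chart_map c p + s *: v).
  exact: cl _ (chart_cod_nbhs cod0).
by apply: filterS H => s /= h; rewrite chart_invK.
Qed.

(** Identities between tangent maps are proved by evaluating them on such a curve and using
    [velocity_unique]. *)
Lemma velocity_curve_ex (p : M) (v : 'rV[R]_n) :
  exists g : R -> M, g 0 = p /\ has_velocity g 0 v.
Proof.
eexists; split; last exact: (chart_line_velocity p v).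
by rewrite /= scale0r addr0 chart_mapK //; exact: chart_at_dom.
Qed.

End CurvesInCharts.

Section SmoothMaps.
Context (R : realType) (n n' : nat) (M : manifoldType R n) (N : manifoldType R n').

(** Common core of transporting a velocity by a map and of changing charts, the latter being the
    case F = id. *)
Lemma is_derive_push (a : chart R n M) (b : chart R n' N) (F : M -> N)
    (g : R -> M) (t : R) (w : 'rV[R]_n) :
  {for t, continuous g} -> chart_dom a (g t) ->
  is_derive t 1 (chart_map a \o g) w ->
  differentiable (chart_map b \o F \o chart_inv a) (chart_map a (g t)) ->
  is_derive t 1 (chart_map b \o (F \o g))
    ('d (chart_map b \o F \o chart_inv a) (chart_map a (g t)) w).
Proof.
move=> cg ag dg dF; apply: near_eq_is_derive (is_derive_diff_comp dg dF).
by apply: filterS (curve_near_chart cg ag) => s /= h; rewrite chart_mapK.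
Qed.

Lemma smooth_map_diff (F : M -> N) (p q : M) (r : N) : smooth_map F ->
  chart_dom (chart_at q) p -> chart_dom (chart_at r) (F p) ->
  differentiable (chart_map (chart_at r) \o F \o chart_inv (chart_at q))
    (chart_map (chart_at q) p).
Proof. by move=> [_ /(_ q r 1%N) [H _]] qp rFp; apply: H; exists p. Qed.

Lemma has_velocity_map (F : M -> N) (g : R -> M) (t : R) (v : 'rV[R]_n) :
  smooth_map F -> has_velocity g t v -> has_velocity (F \o g) t (tmap F (g t) v).
Proof.
move=> sF [cg dg]; split.
  apply: continuous_comp => //; exact: sF.1.
apply: is_derive_push => //; first exact: chart_at_dom.
by apply: smooth_map_diff => //; exact: chart_at_dom.
Qed.

Lemma tmapD (F : M -> N) p v w : tmap F p (v + w) = tmap F p v + tmap F p w.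
Proof. exact: linearD. Qed.

Lemma tmapZ (F : M -> N) p a v : tmap F p (a *: v) = a *: tmap F p v.
Proof. exact: linearZ. Qed.

Lemma tmap0 (F : M -> N) p : tmap F p 0 = 0.
Proof. exact: linear0. Qed.

End SmoothMaps.

Section OneManifold.
Context (R : realType) (n : nat) (M : manifoldType R n).

Lemma chart_transition_diff (p q r : M) : chart_dom (chart_at q) p ->
  chart_dom (chart_at r) p ->
  differentiable (chart_map (chart_at r) \o chart_inv (chart_at q))
    (chart_map (chart_at q) p).
Proof. by move=> qp rp; have [H _] := chart_at_compatible q r 1%N; apply: H; exists p. Qed.

Lemma is_derive_tcoord (q : M) (g : R -> M) (t : R) (v : 'rV[R]_n) :
  has_velocity g t v -> chart_dom (chart_at q) (g t) ->
  is_derive t 1 (chart_map (chart_at q) \o g) (tcoord (chart_at q) (g t) v).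
Proof.
move=> [cg dg] qg.
apply: (@is_derive_push _ _ _ M M (chart_at (g t)) (chart_at q) id) => //.
  exact: chart_at_dom.
by apply: chart_transition_diff => //; exact: chart_at_dom.
Qed.

Lemma has_velocity_chart (q : M) (g : R -> M) (t : R) (w : 'rV[R]_n) :
  {for t, continuous g} -> chart_dom (chart_at q) (g t) ->
  is_derive t 1 (chart_map (chart_at q) \o g) w ->
  has_velocity g t ('d (chart_map (chart_at (g t)) \o chart_inv (chart_at q))
                      (chart_map (chart_at q) (g t)) w).
Proof.
move=> cg qg dg; split => //.
apply: (@is_derive_push _ _ _ M M (chart_at q) (chart_at (g t)) id) => //.
by apply: chart_transition_diff => //; exact: chart_at_dom.
Qed.

(** Inverting the change of coordinates is avoided: an auxiliary curve through the same point with
    velocity v has the same derivative in the chart at q, and [has_velocity_chart] recovers the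
    velocity from that derivative alone. *)
Lemma has_velocity_tcoord (q : M) (g : R -> M) (t : R) (v : 'rV[R]_n) :
  {for t, continuous g} -> chart_dom (chart_at q) (g t) ->
  is_derive t 1 (chart_map (chart_at q) \o g) (tcoord (chart_at q) (g t) v) ->
  has_velocity g t v.
Proof.
move=> cg qg /(has_velocity_chart cg qg).
have [h [h0 hv]] := velocity_curve_ex (g t) v.
have qh : chart_dom (chart_at q) (h 0) by rewrite h0.
have := has_velocity_chart (has_velocity_cont hv) qh (is_derive_tcoord hv qh).
by rewrite h0 => /(velocity_unique hv) <-.
Qed.

Lemma smooth_map_id : smooth_map (id : M -> M).
Proof. by split=> [x|p q]; [exact: cvg_id|exact: chart_at_compatible]. Qed.

Lemma tmap_id (p : M) (v : 'rV[R]_n) : tmap id p v = v.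
Proof.
have [g [g0 gv]] := velocity_curve_ex p v.
have := has_velocity_map smooth_map_id gv.
by rewrite g0 => /(velocity_unique gv).
Qed.

(* As M is Hausdorff, the set where the two curves agree is closed. *)
Lemma curves_agree (A : set R) (g h : R -> M) (s : R) : connected A ->
  (forall t, A t -> {for t, continuous g}) ->
  (forall t, A t -> {for t, continuous h}) ->
  (forall t, A t -> g t = h t -> \forall r \near t, g r = h r) ->
  A s -> g s = h s -> forall t, A t -> g t = h t.
Proof.
move=> cA cg ch agree As gs t At.
pose E := A `&` [set t | g t = h t].
suff : E = A by move=> EA; move: At; rewrite -EA => -[].
apply: cA; first by exists s.
  exists ([set t | g t = h t]°); first exact: open_interior.
  apply/seteqP; split=> r [Ar Hr]; split => //; first exact: agree.
  exact: nbhs_singleton Hr.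
exists (closure E); first exact: closed_closure.
apply/seteqP; split=> r [Ar Hr]; split => //; first exact: subset_closure.
apply: manifold_hausdorff => U V Ug Vh.
have gh_near : nbhs r (g @^-1` U `&` h @^-1` V).
  by apply: filterI; [exact: cg|exact: ch].
have [q [[_ /= gh] [Us Vs]]] := Hr _ gh_near.
by exists (g q); split => //; rewrite gh.
Qed.

(** The mean value inequality with bound 0, in one chart, shows that g is locally constant;
    [curves_agree] against a constant curve then spreads this over A. *)
Lemma zero_velocity_cst (A : set R) (g : R -> M) : open A -> connected A ->
  (forall t, A t -> has_velocity g t (0 : 'rV[R]_n)) ->
  forall s t, A s -> A t -> g t = g s.
Proof.
move=> oA cA g0 s t As At.
have cg r : A r -> {for r, continuous g} by move=> /g0[].
apply: (@curves_agree A g (fun=> g s) s) => //.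
  by move=> r _; exact: cst_continuous.
move=> {t At} t0 At0 <-.
pose c := chart_at (g t0).
have ct0 : chart_dom c (g t0) by exact: chart_at_dom.
have /nbhs_ballP[d /= d0 Hd] : \forall r \near t0, A r /\ chart_dom c (g r).
  apply: filterI; first exact: open_nbhs_nbhs.
  exact: (curve_near_chart (cg _ At0) ct0).
apply/nbhs_ballP; exists d => //= t td.
have inball r : Num.min t0 t <= r <= Num.max t0 t -> A r /\ chart_dom c (g r).
  move=> Hs; apply: Hd; move: td Hs; rewrite -ball_normE /= !ltr_norml.
  by case: (leP t0 t) => ? /andP[? ?] /andP[? ?]; apply/andP; split; lra.
have H : `|(chart_map c \o g) t - (chart_map c \o g) t0| <= 0 * `|t - t0|.
  apply: (mean_value_norm_le (du := fun=> 0)) => // r Hr; last by rewrite normr0.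
  have [Ar cr] := inball r Hr.
  have := is_derive_tcoord (g0 r Ar) cr; congr is_derive; exact: linear0.
move: H; rewrite mul0r normr_le0 subr_eq0 => /eqP /= E.
have [_ ct] : A t /\ chart_dom c (g t).
  by apply: inball; rewrite ge_min le_max !lexx !orbT.
by rewrite -(chart_mapK ct) E chart_mapK.
Qed.

End OneManifold.

(** * Smooth maps of two variables and their velocities *)

Section SmoothMap2.
Context (R : realType) (a b c : nat) (A : manifoldType R a)
  (B : manifoldType R b) (C : manifoldType R c).
Variable F : A -> B -> C.
Hypothesis sF : smooth_map2 F.

Definition map2_repr (p : A) (q : B) (r : C) (uv : 'rV[R]_a * 'rV[R]_b) : 'rV[R]_c :=
  chart_map (chart_at r)
    (F (chart_inv (chart_at p) uv.1) (chart_inv (chart_at q) uv.2)).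

Definition map2_dom (p : A) (q : B) (r : C) : set ('rV[R]_a * 'rV[R]_b) :=
  [set uv | [/\ chart_cod (chart_at p) uv.1, chart_cod (chart_at q) uv.2 &
       chart_dom (chart_at r)
         (F (chart_inv (chart_at p) uv.1) (chart_inv (chart_at q) uv.2))]].

Lemma map2_dom_open p q r : open (map2_dom p q r).
Proof.
pose D : set ('rV[R]_a * 'rV[R]_b) :=
  [set uv | chart_cod (chart_at p) uv.1 /\ chart_cod (chart_at q) uv.2].
have Do : open D.
  rewrite openE => -[u v] /= [pu qv]; exists (chart_cod (chart_at p), chart_cod (chart_at q)).
    by split; exact: chart_cod_nbhs.
  by move=> [u' v'].
have -> : map2_dom p q r = D `&` (fun uv => F (chart_inv (chart_at p) uv.1)
    (chart_inv (chart_at q) uv.2)) @^-1` chart_dom (chart_at r).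
  by apply/seteqP; split=> -[u v]; [move=> []|move=> [[]]].
apply: open_preimageI => //; last exact: chart_dom_open.
move=> [u v] [/= pu qv].
apply: (@continuous_comp _ _ _ (fun uv : 'rV[R]_a * 'rV[R]_b =>
    (chart_inv (chart_at p) uv.1, chart_inv (chart_at q) uv.2))
   (fun xy : A * B => F xy.1 xy.2)); last exact: sF.1.
apply: cvg_pair.
  apply: (@continuous_comp _ _ _ fst (chart_inv (chart_at p))); first exact: cvg_fst.
  exact: chart_inv_cont.
apply: (@continuous_comp _ _ _ snd (chart_inv (chart_at q))); first exact: cvg_snd.
exact: chart_inv_cont.
Qed.

Lemma map2_repr_smooth p q r : smooth_on (map2_repr p q r) (map2_dom p q r).
Proof. exact: sF.2. Qed.

Lemma smooth_map2_l (y : B) : smooth_map (F^~ y).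
Proof.
split=> [x|p r k].
  apply: (@continuous_comp _ _ _ (fun x : A => (x, y)) (fun xy : A * B => F xy.1 xy.2)).
    by apply: cvg_pair; [exact: cvg_id|exact: cvg_cst].
  exact: sF.1.
have yy := chart_at_dom y.
have -> : chart_map (chart_at r) \o F^~ y \o chart_inv (chart_at p) =
    map2_repr p y r \o (fun u => (u, chart_map (chart_at y) y)).
  by apply/funext => u; rewrite /map2_repr /= chart_mapK.
have oU : open (chart_map (chart_at p) @`
    (chart_dom (chart_at p) `&` F^~ y @^-1` chart_dom (chart_at r))).
  apply: chart_map_image_open; rewrite -[X in open X]setTI.
  apply: open_preimageI; [exact: openT| |exact: chart_dom_open].
  move=> x _.
  apply: (@continuous_comp _ _ _ (fun x : A => (x, y)) (fun xy : A * B => F xy.1 xy.2)).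
    by apply: cvg_pair; [exact: cvg_id|exact: cvg_cst].
  exact: sF.1.
apply: (Ck_comp _ oU (@map2_dom_open p y r)).
- by apply: prod_has_coords; exact: rV_has_coords.
- move=> _ [x [px rx] <-]; split => /=; rewrite ?chart_mapK //; exact: chart_cod_map.
- apply: Ck_pair => //; last exact: Ck_cst.
  by apply: (@Ck_lin _ _ _ _ (idfun : {linear 'rV[R]_a -> 'rV[R]_a})) => x; exact: cvg_id.
- exact: map2_repr_smooth.
Qed.

End SmoothMap2.

Lemma smooth_map2_swap (R : realType) (a b c : nat) (A : manifoldType R a)
    (B : manifoldType R b) (C : manifoldType R c) (F : A -> B -> C) :
  smooth_map2 F -> smooth_map2 (fun y x => F x y).
Proof.
have swap_cont (X Y : topologicalType) : continuous (fun z : X * Y => (z.2, z.1)).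
  by move=> z; apply: cvg_pair; [exact: cvg_snd|exact: cvg_fst].
move=> sF; split=> [yx|p q r k].
  apply: (@continuous_comp _ _ _ (fun z : B * A => (z.2, z.1))
            (fun xy : A * B => F xy.1 xy.2)); [exact: swap_cont|exact: sF.1].
pose sw (z : 'rV[R]_b * 'rV[R]_a) := (z.2, z.1).
have oU : open (sw @^-1` map2_dom F q p r).
  rewrite -[X in open X]setTI; apply: open_preimageI; first exact: openT.
    by move=> z _; exact: swap_cont.
  exact: map2_dom_open.
have -> : [set uv | [/\ chart_cod (chart_at p) uv.1, chart_cod (chart_at q) uv.2 &
       chart_dom (chart_at r)
         (F (chart_inv (chart_at q) uv.2) (chart_inv (chart_at p) uv.1))]]
  = sw @^-1` map2_dom F q p r.
  by apply/seteqP; split=> -[u v] [].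
apply: (@Ck_comp _ _ _ _ _ sw (map2_repr F q p r) _ (map2_dom F q p r)) => //.
- by apply: prod_has_coords; exact: rV_has_coords.
- exact: map2_dom_open.
- apply: Ck_pair => //.
    by apply: (@Ck_lin _ _ _ _ (snd : {linear _ -> _})) => z; exact: cvg_snd.
  by apply: (@Ck_lin _ _ _ _ (fst : {linear _ -> _})) => z; exact: cvg_fst.
- exact: map2_repr_smooth.
Qed.

Section SmoothMap2Velocity.
Context (R : realType) (a b c : nat) (A : manifoldType R a)
  (B : manifoldType R b) (C : manifoldType R c).
Variable F : A -> B -> C.
Hypothesis sF : smooth_map2 F.

Lemma smooth_map2_r (x : A) : smooth_map (F x).
Proof. exact: (smooth_map2_l (smooth_map2_swap sF) x). Qed.

Lemma diff_partial_l (Ps : 'rV[R]_a * 'rV[R]_b -> 'rV[R]_c) u w v :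
  differentiable Ps (u, w) -> 'd Ps (u, w) (v, 0) = 'd (fun x => Ps (x, w)) u v.
Proof.
move=> dP.
have [dp pE] : is_diff u (fun x : 'rV[R]_a => (x, w)) (fun y => (y, 0)).
  exact: (is_diff_pair (is_diff_id u) (is_diff_cst w u)).
rewrite -[fun x => Ps (x, w)]/(Ps \o (fun x => (x, w))).
by rewrite [in RHS]diff_comp //= pE.
Qed.

Lemma diff_partial_r (Ps : 'rV[R]_a * 'rV[R]_b -> 'rV[R]_c) u w v :
  differentiable Ps (u, w) -> 'd Ps (u, w) (0, v) = 'd (fun x => Ps (u, x)) w v.
Proof.
move=> dP.
have [dp pE] : is_diff w (fun x : 'rV[R]_b => (u, x)) (fun y => (0, y)).
  exact: (is_diff_pair (is_diff_cst u w) (is_diff_id w)).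
rewrite -[fun x => Ps (u, x)]/(Ps \o (fun x => (u, x))).
by rewrite [in RHS]diff_comp //= pE.
Qed.

Lemma diff_partials (Ps : 'rV[R]_a * 'rV[R]_b -> 'rV[R]_c) u w v z :
  differentiable Ps (u, w) ->
  'd Ps (u, w) (v, z) = 'd (fun x => Ps (x, w)) u v + 'd (fun x => Ps (u, x)) w z.
Proof.
move=> dP; rewrite -diff_partial_l // -diff_partial_r // -linearD.
by congr ('d _ _ _); congr pair; rewrite ?addr0 ?add0r.
Qed.

Lemma has_velocity_map2 (g : R -> A) (h : R -> B) (t : R) v w :
  has_velocity g t v -> has_velocity h t w ->
  has_velocity (fun s => F (g s) (h s)) t
    (tmap (F^~ (h t)) (g t) v + tmap (F (g t)) (h t) w).
Proof.
move=> [cg dg] [ch dh]; split.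
  apply: (@continuous_comp _ _ _ (fun s => (g s, h s)) (fun xy : A * B => F xy.1 xy.2)).
    exact: cvg_pair.
  exact: sF.1.
set x := g t in dg *; set y := h t in dh *.
have xx := chart_at_dom x; have yy := chart_at_dom y.
have zz := chart_at_dom (F x y).
pose u := chart_map (chart_at x) x; pose z := chart_map (chart_at y) y.
pose Ps := map2_repr F x y (F x y).
have dP : differentiable Ps (u, z).
  have [H _] := map2_repr_smooth sF x y (F x y) 1%N; apply: H.
  by split => /=; rewrite ?chart_mapK //; exact: chart_cod_map.
pose uv s := ((chart_map (chart_at x) \o g) s, (chart_map (chart_at y) \o h) s).
have duv : is_derive t 1 uv (v, w).
  case: dg => /derivable1_diffP dg <-; case: dh => /derivable1_diffP dh <-.
  have dgh := differentiable_pair dg dh.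
  split; first exact/derivable1_diffP.
  by rewrite deriveE // diff_pair // (deriveE _ dg) (deriveE _ dh).
have dE := diff_partials v w dP.
have H : is_derive t 1 (Ps \o uv)
    ('d (fun x => Ps (x, z)) u v + 'd (fun x => Ps (u, x)) z w).
  by rewrite -dE; exact: (is_derive_diff_comp duv dP).
have Hl : (fun r => Ps (r, z)) =
    chart_map (chart_at (F x y)) \o F^~ y \o chart_inv (chart_at x).
  by apply/funext => r; rewrite /Ps /map2_repr /= /z chart_mapK.
have Hr : (fun r => Ps (u, r)) =
    chart_map (chart_at (F x y)) \o F x \o chart_inv (chart_at y).
  by apply/funext => r; rewrite /Ps /map2_repr /= /u chart_mapK.
rewrite Hl Hr in H; rewrite /tmap; apply: near_eq_is_derive H.
apply: filterS2 (curve_near_chart cg xx) (curve_near_chart ch yy) => s gs hs.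
by rewrite /Ps /map2_repr /= !chart_mapK.
Qed.

End SmoothMap2Velocity.

Lemma setT_connected (R : realType) : connected [set: R].
Proof. exact/connected_intervalP. Qed.

Lemma tmap_comp (R : realType) a b c (A : manifoldType R a) (B : manifoldType R b)
    (C : manifoldType R c) (F : A -> B) (G : B -> C) (p : A) (v : 'rV[R]_a) :
  smooth_map F -> smooth_map G -> smooth_map (G \o F) ->
  tmap (G \o F) p v = tmap G (F p) (tmap F p v).
Proof.
move=> sF sG sGF; have [g [g0 gv]] := velocity_curve_ex p v.
have h1 := has_velocity_map sGF gv.
have h2 := has_velocity_map sG (has_velocity_map sF gv).
by rewrite /= g0 in h1 h2; exact: velocity_unique h1 h2.
Qed.

(** * Existence and uniqueness of integral curves *)

Section IntegralCurves.
Context (R : realType) (n : nat) (M : manifoldType R n) (X : M -> 'rV[R]_n).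
Hypothesis sX : smooth_vector_field X.

Let F (q : M) (u : 'rV[R]_n) :=
  let p := chart_inv (chart_at q) u in tcoord (chart_at q) p (X p).

Lemma integral_curve_locally_ex (p : M) : exists (d : R) (g : R -> M),
  [/\ 0 < d, g 0 = p & forall t, `|t| < d -> has_velocity g t (X (g t))].
Proof.
pose c := chart_at p; have cp : chart_dom c p by exact: chart_at_dom.
have [d [u [d0 u0 Hu]]] :=
  picard_C1 (@chart_cod_open _ _ _ c) (chart_cod_map cp) (sX p 1%N : Ck 1 (F p) _).
exists d, (chart_inv c \o u); split => //; first by rewrite /= u0 chart_mapK.
move=> t td; have [Uut dut] := Hu t td.
have cut : {for t, continuous u}.
  by apply/differentiable_continuous/derivable1_diffP; have [] := dut.
apply: (@has_velocity_tcoord _ _ _ p).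
- exact: (continuous_comp cut (chart_inv_cont Uut)).
- exact: chart_inv_dom.
- apply: near_eq_is_derive dut.
  have : \forall s \near t, chart_cod c (u s) := cut _ (chart_cod_nbhs Uut).
  by apply: filterS => s us /=; rewrite chart_invK.
Qed.

(** Uniqueness for the equation read in a chart gives agreement near any time where the curves meet,
    which is what [curves_agree] needs. The set A is needed because some curves are integral curves
    for small times only. *)
Lemma integral_curve_unique_on (A : set R) (g h : R -> M) (s : R) :
  open A -> connected A -> A s -> g s = h s ->
  (forall t, A t -> has_velocity g t (X (g t))) ->
  (forall t, A t -> has_velocity h t (X (h t))) ->
  forall t, A t -> g t = h t.
Proof.
move=> oA cA As gs gX hX.
have cg r : A r -> {for r, continuous g} by move=> /gX[].
have ch r : A r -> {for r, continuous h} by move=> /hX[].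
apply: (@curves_agree _ _ _ A g h s) => //.
move=> t At gh; have An := open_nbhs_nbhs (conj oA At); pose c := chart_at (g t).
have cgt : chart_dom c (g t) by exact: chart_at_dom.
have cht : chart_dom c (h t) by rewrite -gh.
have gc := curve_near_chart (cg t At) cgt; have hc := curve_near_chart (ch t At) cht.
have H : \forall r \near t, (chart_map c \o g) r = (chart_map c \o h) r.
  apply: (ode_locally_unique (@chart_cod_open _ _ _ c) (chart_cod_map cgt)
     (sX (g t) 1%N : Ck 1 (F (g t)) _)) => /=; first by rewrite gh.
    apply: filterS2 An gc => r Ar cr; rewrite /F chart_mapK //.
    exact: is_derive_tcoord (gX r Ar) cr.
  apply: filterS2 An hc => r Ar cr; rewrite /F chart_mapK //.
  exact: is_derive_tcoord (hX r Ar) cr.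
near=> r; rewrite -[LHS](@chart_mapK _ _ _ c); last by near: r.
rewrite -[RHS](@chart_mapK _ _ _ c); last by near: r.
by congr chart_inv; near: r.
Unshelve. all: by end_near. Qed.

Lemma integral_curve_unique (m : M) (g h : R -> M) :
  integral_curve X m g -> integral_curve X m h -> g =1 h.
Proof.
move=> [g0 gX] [h0 hX] t.
apply: (@integral_curve_unique_on setT _ _ 0) => //; first exact: openT.
  exact: setT_connected.
by rewrite g0.
Qed.

End IntegralCurves.

(** * Lie groups and their exponential map *)

Section LeftInvariant.
Context (R : realType) (k : nat) (K : lieGroupType R k).
Implicit Types (x y p : K) (xi eta : 'rV[R]_k).

Lemma lmul_smooth x : smooth_map (fun y : K => (x * y)%g).
Proof. exact: (smooth_map2_r (lie_mul_smooth (s := K)) x). Qed.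

Lemma rmul_smooth x : smooth_map (fun y : K => (y * x)%g).
Proof. exact: (smooth_map2_l (lie_mul_smooth (s := K)) x). Qed.

Definition left_invariant xi (p : K) : 'rV[R]_k :=
  tmap (fun y : K => (p * y)%g) 1%g xi.

Lemma left_invariant1 xi : left_invariant xi 1%g = xi.
Proof.
rewrite /left_invariant (_ : (fun y => _) = id) ?tmap_id //.
by apply/funext => y; rewrite mul1g.
Qed.

Lemma left_invariant_lmul xi x p :
  tmap (fun y : K => (x * y)%g) p (left_invariant xi p) = left_invariant xi (x * p)%g.
Proof.
rewrite /left_invariant.
have E : (fun y : K => (x * p * y)%g) = (fun y => (x * y)%g) \o (fun y => (p * y)%g).
  by apply/funext => y; rewrite /= mulgA.
rewrite E [RHS]tmap_comp; [|exact: lmul_smooth|exact: lmul_smooth|].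
  by rewrite /= mulg1.
by rewrite -E; exact: lmul_smooth.
Qed.

Lemma left_invariant_curve xi p (g : R -> K) : g 0 = 1%g -> has_velocity g 0 xi ->
  has_velocity (fun s => (p * g s)%g) 0 (left_invariant xi p).
Proof.
move=> g0 gxi; have := has_velocity_map (lmul_smooth p) gxi.
by rewrite g0.
Qed.

(** In a chart, the field is the derivative in the fixed direction (0, xi) of the coordinate
    expression of the product, taken at (u, u1) with u1 the coordinates of 1. Both are obtained by
    differentiating p * g(s) at s = 0, for a curve g with velocity xi. *)
Lemma left_invariant_smooth xi : smooth_vector_field (left_invariant xi).
Proof.
move=> q l; set c := chart_at q.
have [g [g0 gxi]] := velocity_curve_ex (1%g : K) xi.
pose c1 := chart_at (1%g : K); pose u1 := chart_map c1 (1%g : K).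
have c11 : chart_dom c1 (1%g : K) by exact: chart_at_dom.
pose Ps := map2_repr (fun x y : K => (x * y)%g) q 1%g q.
have sPs := map2_repr_smooth (lie_mul_smooth (s := K)) q 1%g q.
have oD : open (map2_dom (fun x y : K => (x * y)%g) q 1%g q).
  by apply: map2_dom_open; exact: (lie_mul_smooth (s := K)).
have D u : chart_cod c u -> map2_dom (fun x y : K => (x * y)%g) q 1%g q (u, u1).
  move=> cu; split => //=; first exact: chart_cod_map.
  by rewrite chart_mapK // mulg1; exact: chart_inv_dom.
have cO : open (chart_cod c) by exact: chart_cod_open.
apply: (@Ck_eq _ _ _ _ ((fun z => 'D_(0, xi) Ps z) \o (fun u => (u, u1)))) => //.
  move=> u cu /=; set p := chart_inv c u.
  have [dPs _] := sPs 1%N; have {}dPs := dPs _ (D u cu).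
  rewrite deriveE // diff_partial_r //.
  have cg : {for 0, continuous g} by have [] := gxi.
  have dg : is_derive (0 : R) 1 (chart_map c1 \o g) xi.
    by have [_] := gxi; rewrite g0.
  have dP2 : differentiable (fun z => Ps (u, z)) (chart_map c1 (g 0)).
    rewrite g0 -/u1 (_ : (fun z => _) = Ps \o (fun z => (u, z))) //.
    apply: differentiable_comp => //; exact: differentiable_pair.
  have := is_derive_diff_comp dg dP2; rewrite /= g0 -/u1 => H1.
  have H2 := is_derive_tcoord (q := q) (left_invariant_curve p g0 gxi).
  move: H2; rewrite g0 mulg1 => /(_ (chart_inv_dom cu)) H2.
  have {}H1 : is_derive (0 : R) 1 (chart_map c \o (fun s : R => (p * g s)%g))
      ('d (fun z => Ps (u, z)) u1 xi).
    apply: near_eq_is_derive H1.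
    have c1g : chart_dom c1 (g 0) by rewrite g0.
    apply: filterS (curve_near_chart cg c1g) => s c1s.
    by rewrite /Ps /map2_repr /= chart_mapK.
  by case: H1 => _ <-; case: H2 => _ <-.
apply: (Ck_comp _ cO oD D).
- by apply: prod_has_coords; exact: rV_has_coords.
- apply: Ck_pair => //; last exact: Ck_cst.
  by apply: (@Ck_lin _ _ _ _ (idfun : {linear 'rV[R]_k -> 'rV[R]_k})) => x; exact: cvg_id.
- by have [_] := sPs l.+1; exact.
Qed.

Lemma left_invariant_translate xi x (g : R -> K) t :
  has_velocity g t (left_invariant xi (g t)) ->
  has_velocity (fun s => (x * g s)%g) t (left_invariant xi (x * g t)%g).
Proof.
move=> /(has_velocity_map (lmul_smooth x)).
by rewrite left_invariant_lmul.
Qed.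

Lemma one_parameter_subgroup1 (g : R -> K) xi : one_parameter_subgroup g xi -> g 0 = 1%g.
Proof.
move=> [gD _]; have := gD 0 0; rewrite addr0 => H.
by apply: (mulgI (g 0)); rewrite mulg1 -H.
Qed.

Lemma one_parameter_subgroup_velocity (g : R -> K) xi t :
  one_parameter_subgroup g xi -> has_velocity g t (left_invariant xi (g t)).
Proof.
move=> Hg; have g0 := one_parameter_subgroup1 Hg; have [gD gxi] := Hg.
apply/has_velocity_shift; have := left_invariant_curve (g t) g0 gxi.
by congr has_velocity; apply/funext => s; rewrite gD.
Qed.

Lemma one_parameter_subgroup_unique (g h : R -> K) xi :
  one_parameter_subgroup g xi -> one_parameter_subgroup h xi -> g =1 h.
Proof.
move=> Hg Hh; apply: (integral_curve_unique (left_invariant_smooth xi) (m := 1%g)).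
  split; first exact: one_parameter_subgroup1 Hg.
  by move=> t; exact: one_parameter_subgroup_velocity.
split; first exact: one_parameter_subgroup1 Hh.
by move=> t; exact: one_parameter_subgroup_velocity.
Qed.

(** By left invariance, t |-> g (s + t) and t |-> g s * g t are integral curves of the same field
    through g s. They are compared for |t| < d - |s|, where g is known to be an integral curve at
    both s + t and t. *)
Lemma local_subgroup_ex xi : exists (d : R) (g : R -> K), [/\ 0 < d,
  has_velocity g 0 xi & forall s t, `|s| + `|t| < d -> g (s + t) = (g s * g t)%g].
Proof.
have [d [g [d0 g0 Hg]]] := integral_curve_locally_ex (left_invariant_smooth xi) 1%g.
exists d, g; split => //.
  by have := Hg 0; rewrite normr0 g0 left_invariant1; exact.
move=> s t st.
pose r := d - `|s|.
have tr : ball (0 : R) r t by rewrite -ball_normE /= sub0r normrN /r; lra.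
have r0 : 0 < r by rewrite /r; have := normr_ge0 t; lra.
apply: (@integral_curve_unique_on _ _ _ _ (left_invariant_smooth xi) (ball 0 r)
  (fun t => g (s + t)) (fun t => (g s * g t)%g) 0) => //.
- exact: ball_open.
- by apply/connected_intervalP; rewrite ball_itv; exact: interval_is_interval.
- exact: ballxx.
- by rewrite addr0 g0 mulg1.
- move=> q; rewrite -ball_normE /= sub0r normrN => qr.
  apply: has_velocity_addl; apply: Hg; apply: le_lt_trans (ler_normD _ _) _.
  by rewrite /r in qr; lra.
- move=> q; rewrite -ball_normE /= sub0r normrN => qr.
  apply: left_invariant_translate; apply: Hg.
  by rewrite /r in qr; have := normr_ge0 s; lra.
Qed.

End LeftInvariant.

Section Exponential.
Context (R : realType) (k : nat) (K : lieGroupType R k).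
Implicit Types (x y p : K) (xi eta : 'rV[R]_k).

(* A local one-parameter subgroup g extends by t |-> g (t / N) ^ N, where N is large
   depending on t. *)
Lemma one_parameter_subgroup_ex xi : exists g : R -> K, one_parameter_subgroup g xi.
Proof.
have [d [g [d0 gxi gD]]] := local_subgroup_ex K xi.
have g0 : g 0 = 1%g.
  have := gD 0 0; rewrite normr0 !addr0 => /(_ d0) H.
  by apply: (mulgI (g 0)); rewrite mulg1 -H.
have gX n (t : R) : n%:R * `|t| < d -> g (n%:R * t) = (g t ^+ n)%g.
  elim: n => [|n IH] nt; first by rewrite mul0r expg0.
  have nt' : n%:R * `|t| + `|t| < d by move: nt; rewrite -natr1 mulrDl mul1r.
  rewrite -natr1 mulrDl mul1r gD; last by rewrite normrM normr_nat.
  by rewrite IH ?expgSr //; have := normr_ge0 t; lra.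
have rescale (t : R) n m : `|t| < d * n.+1%:R ->
    (g (t / n.+1%:R)%R ^+ n.+1 = g (t / (n.+1 * m.+1)%:R)%R ^+ (n.+1 * m.+1))%g.
  move=> td; have n0 : 0 < n.+1%:R :> R by rewrite ltr0n.
  have m0 : 0 < m.+1%:R :> R by rewrite ltr0n.
  rewrite mulnC expgnA; congr (_ ^+ _)%g; rewrite -gX.
    by congr g; rewrite natrM; field; rewrite !gt_eqF.
  rewrite normrM normfV normr_nat natrM mulrCA invfM mulVKf ?gt_eqF //.
  by rewrite ltr_pdivrMr.
have /choice[N HN] (t : R) : exists n, `|t| < d * n.+1%:R.
  exists (Num.truncn (`|t| / d)); rewrite mulrC -ltr_pdivrMr //.
  exact: truncnS_gt.
pose G t := (g (t / (N t).+1%:R)%R ^+ (N t).+1)%g.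
have GE (t : R) n : `|t| < d * n.+1%:R -> G t = (g (t / n.+1%:R)%R ^+ n.+1)%g.
  by move=> tn; rewrite /G (rescale t (N t) n) // (rescale t n (N t)) // mulnC.
exists G; split.
  move=> s t; have [n Hn] : exists n, `|s| + `|t| < d * n.+1%:R.
    exists (N (`|s| + `|t|)).
    by have := HN (`|s| + `|t|); rewrite ger0_norm // addr_ge0.
  have hs : `|s| < d * n.+1%:R by apply: le_lt_trans Hn; rewrite lerDl.
  have ht : `|t| < d * n.+1%:R by apply: le_lt_trans Hn; rewrite lerDr.
  rewrite (GE (s + t) n) ?(GE s n) ?(GE t n) //; last first.
    exact: le_lt_trans (ler_normD _ _) Hn.
  have n0 : 0 < n.+1%:R :> R by rewrite ltr0n.
  have Hn' : `|s / n.+1%:R| + `|t / n.+1%:R| < d.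
    by rewrite !normrM normfV normr_nat -mulrDl ltr_pdivrMr.
  rewrite mulrDl gD // expgMn //.
  by rewrite /commute -!gD // addrC // addrC.
apply: near_eq_has_velocity gxi.
apply/nbhs_ballP; exists d => //= t; rewrite -ball_normE /= sub0r normrN => td.
by rewrite (GE t 0%N) ?mulr1 // divr1 expg1.
Qed.

Lemma one_parameter_subgroup_scale (g : R -> K) xi (a : R) :
  one_parameter_subgroup g xi -> one_parameter_subgroup (fun t => g (t * a)) (a *: xi).
Proof.
move=> [gD gxi]; split; first by move=> s t; rewrite mulrDl gD.
have := @has_velocity_affine _ _ K g 0 a 0 xi; rewrite mul0r addr0 => /(_ gxi).
by congr has_velocity; apply/funext => s; rewrite add0r.
Qed.

(** The subgroup with velocity t xi is s |-> g (s t), whose value at 1 is g t; uniqueness identifies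
    it with the one picked by [xget]. *)
Lemma lie_expE (g : R -> K) xi : one_parameter_subgroup g xi ->
  forall t, lie_exp K (t *: xi) = g t.
Proof.
move=> Hg t; have Hgt := one_parameter_subgroup_scale t Hg.
rewrite /lie_exp; case: xgetP => [h -> Hh|/(_ _ Hgt) //].
by rewrite (one_parameter_subgroup_unique Hh Hgt) mul1r.
Qed.

Lemma lie_exp_subgroup xi : one_parameter_subgroup (fun t : R => lie_exp K (t *: xi)) xi.
Proof.
have [g Hg] := one_parameter_subgroup_ex xi.
by rewrite (_ : (fun t => _) = g) //; apply/funext; exact: lie_expE.
Qed.

Lemma lie_expD xi (s t : R) :
  lie_exp K ((s + t) *: xi) = (lie_exp K (s *: xi) * lie_exp K (t *: xi))%g.
Proof. by have [-> _] := lie_exp_subgroup xi. Qed.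

Lemma lie_exp0 xi : lie_exp K ((0 : R) *: xi) = 1%g.
Proof. exact: one_parameter_subgroup1 (lie_exp_subgroup xi). Qed.

Lemma lie_expN xi (t : R) : lie_exp K ((- t) *: xi) = (lie_exp K (t *: xi))^-1%g.
Proof. by apply: (mulIg (lie_exp K (t *: xi))); rewrite mulVg -lie_expD addNr lie_exp0. Qed.

Lemma lie_exp_velocity0 xi : has_velocity (fun t : R => lie_exp K (t *: xi)) 0 xi.
Proof. by have [] := lie_exp_subgroup xi. Qed.

Lemma lie_exp_velocity0N xi :
  has_velocity (fun t : R => lie_exp K ((- t) *: xi)) 0 (- xi).
Proof.
have := @has_velocity_affine _ _ K (fun t => lie_exp K (t *: xi)) 0 (-1) 0 xi.
rewrite mul0r addr0 scaleN1r => /(_ (lie_exp_velocity0 xi)).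
by congr has_velocity; apply/funext => s; rewrite add0r mulrN1.
Qed.

End Exponential.

(** * Smoothness of curves and parametrizations *)

(** Smoothness of a parametrization: R, R^d and chart codomains serve as sources without being given
    an atlas. *)
Definition smooth_into (R : realType) (n : nat) (M : manifoldType R n)
    (V : normedModType R) (f : V -> M) (U : set V) : Prop :=
  (forall x, U x -> {for x, continuous f}) /\
  forall q, smooth_on (chart_map (chart_at q) \o f)
              (U `&` f @^-1` chart_dom (chart_at q)).

Section SmoothInto.
Context (R : realType) (n : nat) (M : manifoldType R n).

Lemma smooth_into_open (V : normedModType R) (f : V -> M) (U : set V) (q : M) :
  open U -> smooth_into f U -> open (U `&` f @^-1` chart_dom (chart_at q)).
Proof. by move=> oU [cf _]; apply: open_preimageI => //; exact: chart_dom_open. Qed.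

Lemma smooth_into_comp n' (N : manifoldType R n') (V : normedModType R) (f : V -> M)
    (U : set V) (G : M -> N) : open U -> smooth_into f U -> smooth_map G ->
  smooth_into (G \o f) U.
Proof.
move=> oU sf sG; split=> [x Ux|r k].
  by apply: continuous_comp; [exact: sf.1|exact: sG.1].
apply: Ck_local => x [Ux rx]; pose q := f x.
pose D := U `&` f @^-1` chart_dom (chart_at q).
pose O := chart_dom (chart_at q) `&` G @^-1` chart_dom (chart_at r).
have oO : open (chart_map (chart_at q) @` O).
  apply: chart_map_image_open; rewrite -[X in open X]setTI.
  apply: open_preimageI; [exact: openT|by move=> y _; exact: sG.1|].
  exact: chart_dom_open.
have oD : open (D `&` (G \o f) @^-1` chart_dom (chart_at r)).
  apply: open_preimageI; [exact: smooth_into_open| |exact: chart_dom_open].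
  by move=> y [Uy _]; apply: continuous_comp; [exact: sf.1|exact: sG.1].
exists (D `&` (G \o f) @^-1` chart_dom (chart_at r)).
  by split => //; split => //; exact: chart_at_dom.
apply: (@Ck_eq _ _ _ _ ((chart_map (chart_at r) \o G \o chart_inv (chart_at q)) \o
   (chart_map (chart_at q) \o f))) => //.
  by move=> y [[Uy qy] ry] /=; rewrite chart_mapK.
apply: (Ck_comp (rV_has_coords R n) oD oO).
- by move=> y [[Uy qy] ry]; exists (f y).
- by apply: Ck_sub (sf.2 q k); apply: subIsetl.
- exact: (sG.2 q r k).
Qed.

Lemma smooth_map_intoP n' (N : manifoldType R n') (F : M -> N) : smooth_map F <->
  continuous F /\
  forall p, smooth_into (F \o chart_inv (chart_at p)) (chart_cod (chart_at p)).
Proof.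
have E p q : chart_map (chart_at p) @` (chart_dom (chart_at p) `&`
      F @^-1` chart_dom (chart_at q)) = chart_cod (chart_at p) `&`
      (F \o chart_inv (chart_at p)) @^-1` chart_dom (chart_at q).
  exact: chart_map_image.
split=> [[cF sF]|[cF sF]]; split => //.
  move=> p; split=> [u cu|q].
    by apply: continuous_comp; [exact: chart_inv_cont|exact: cF].
  by rewrite -E; exact: sF.
by move=> p q; rewrite E; exact: (sF p).2.
Qed.

Lemma smooth_into_precomp (V W : normedModType R) (L : V -> W) (f : W -> M) :
  has_coords W -> continuous L -> (forall k, Ck k L setT) ->
  smooth_into f setT -> smooth_into (f \o L) setT.
Proof.
move=> cW cL sL sf; split=> [x _|q k].
  by apply: continuous_comp; [exact: cL|exact: sf.1].
have oO := @smooth_into_open W f setT q openT sf.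
apply: (@Ck_comp _ _ _ _ k L (chart_map (chart_at q) \o f) _ _ cW _ oO) => //; last exact: sf.2.
  apply: open_preimageI; first exact: openT.
    by move=> x _; apply: continuous_comp; [exact: cL|exact: sf.1].
  exact: chart_dom_open.
exact: Ck_sub (sL k).
Qed.

Lemma integral_curve_smooth (X : M -> 'rV[R]_n) (f : R -> M) :
  smooth_vector_field X -> (forall t, has_velocity f t (X (f t))) ->
  smooth_into f setT.
Proof.
move=> sX fX; have cf t : {for t, continuous f} by have [] := fX t.
split=> // q k; set c := chart_at q.
have oW : open (setT `&` f @^-1` chart_dom c).
  by apply: open_preimageI => //; [exact: openT|exact: chart_dom_open].
pose F u := let p := chart_inv c u in tcoord c p (X p).
have df t : chart_dom c (f t) -> is_derive t 1 (chart_map c \o f) (F (chart_map c (f t))).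
  by move=> ct; rewrite /F chart_mapK //; exact: is_derive_tcoord.
(* As y' = F y, the curve y is of class C^(k+1) as soon as it is of class C^k. *)
elim: k => [|k IH].
  move=> t [_ ct]; apply/differentiable_continuous/derivable1_diffP.
  by have [] := df t ct.
split=> [t [_ ct]|v]; first by apply/derivable1_diffP; have [] := df t ct.
apply: (@Ck_eq _ _ _ _ (fun t => v *: (F \o (chart_map c \o f)) t)) => //.
  move=> t [_ ct]; have [dt E] := df t ct.
  have {}dt : differentiable (chart_map c \o f) t by exact/derivable1_diffP.
  rewrite [RHS]deriveE // -{2}[v]mulr1 -[v * 1]/(v *: (1 : R)) linearZ /=.
  by rewrite -deriveE // E.
apply: Ck_scale => //; first exact: Ck_cst.
apply: (Ck_comp (rV_has_coords R n) oW (@chart_cod_open _ _ _ c) _ IH).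
  by move=> t [_ ct]; exact: chart_cod_map.
exact: (sX q k).
Qed.

End SmoothInto.

Lemma smooth_map_comp (R : realType) n n1 n2 (M : manifoldType R n)
    (N : manifoldType R n1) (P : manifoldType R n2)
    (F : M -> N) (G : N -> P) : smooth_map F -> smooth_map G -> smooth_map (G \o F).
Proof.
move=> /smooth_map_intoP[cF sF] sG; apply/smooth_map_intoP; split.
  by move=> x; apply: continuous_comp; [exact: cF|exact: sG.1].
by move=> p; apply: (smooth_into_comp _ (sF p) sG); exact: chart_cod_open.
Qed.

Lemma smooth_into_map2 (R : realType) a b c (A : manifoldType R a) (B : manifoldType R b)
    (C : manifoldType R c) (F : A -> B -> C) (V : normedModType R) (U : set V)
    (f : V -> A) (g : V -> B) : smooth_map2 F -> open U ->
  smooth_into f U -> smooth_into g U -> smooth_into (fun x => F (f x) (g x)) U.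
Proof.
move=> sF oU sf sg.
have cFfg x : U x -> {for x, continuous (fun x => F (f x) (g x))}.
  move=> Ux; apply: (@continuous_comp _ _ _ (fun s => (f s, g s))
    (fun xy : A * B => F xy.1 xy.2)).
    by apply: cvg_pair; [exact: sf.1|exact: sg.1].
  exact: sF.1.
split=> // r k; apply: Ck_local => x [Ux rx]; pose p := f x; pose q := g x.
pose D := (U `&` f @^-1` chart_dom (chart_at p)) `&` (U `&` g @^-1` chart_dom (chart_at q)).
have oD : open (D `&` (fun x => F (f x) (g x)) @^-1` chart_dom (chart_at r)).
  apply: open_preimageI; last exact: chart_dom_open.
    by apply: openI; exact: smooth_into_open.
  by move=> y [[Uy _] _]; exact: cFfg.
exists (D `&` (fun x => F (f x) (g x)) @^-1` chart_dom (chart_at r)).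
  by split => //; split; split => //; exact: chart_at_dom.
apply: (@Ck_eq _ _ _ _ (map2_repr F p q r \o
   (fun x => ((chart_map (chart_at p) \o f) x, (chart_map (chart_at q) \o g) x)))) => //.
  by move=> y [[[_ py] [_ qy]] ry]; rewrite /map2_repr /= !chart_mapK.
have oE : open (map2_dom F p q r) by exact: map2_dom_open.
apply: (Ck_comp _ oD oE).
- by apply: prod_has_coords; exact: rV_has_coords.
- move=> y [[[_ py] [_ qy]] ry]; split => /=; rewrite ?chart_mapK //; exact: chart_cod_map.
- apply: Ck_pair => //.
    by apply: Ck_sub (sf.2 p k) => y [[]].
  by apply: Ck_sub (sg.2 q k) => y [[]].
- exact: map2_repr_smooth.
Qed.

(** * Smooth actions and relative equilibria *)

Section GroupVelocities.
Context (R : realType) (k : nat) (K : lieGroupType R k).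
Implicit Types (x y : K) (xi eta : 'rV[R]_k).

Lemma mul_velocity1 (g h : R -> K) xi eta : g 0 = 1%g -> h 0 = 1%g ->
  has_velocity g 0 xi -> has_velocity h 0 eta ->
  has_velocity (fun s => (g s * h s)%g) 0 (xi + eta).
Proof.
move=> g0 h0 gxi heta.
have := has_velocity_map2 (lie_mul_smooth (s := K)) gxi heta; rewrite g0 h0.
have E1 : (fun y : K => (y * 1)%g) = id by apply/funext => y; rewrite mulg1.
have E2 : (fun y : K => (1 * y)%g) = id by apply/funext => y; rewrite mul1g.
rewrite E1 E2.
by rewrite !tmap_id.
Qed.

Lemma conj_smooth x : smooth_map (fun y : K => (x * y * x^-1)%g).
Proof. exact: (smooth_map_comp (lmul_smooth x) (rmul_smooth x^-1%g)). Qed.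

Lemma lie_exp_smooth xi : smooth_into (fun t : R => lie_exp K (t *: xi)) setT.
Proof.
apply: (integral_curve_smooth (left_invariant_smooth xi)) => t.
exact: (one_parameter_subgroup_velocity t (lie_exp_subgroup K xi)).
Qed.

Lemma conj_velocity x (g : R -> K) xi : g 0 = 1%g -> has_velocity g 0 xi ->
  has_velocity (fun s => (x * g s * x^-1)%g) 0 (Ad x xi).
Proof. by move=> g0 gxi; have := has_velocity_map (conj_smooth x) gxi; rewrite g0. Qed.

End GroupVelocities.

Section SmoothActions.
Context (R : realType) (k n : nat) (K : lieGroupType R k) (M : manifoldType R n).
Context (act : K -> M -> M).
Hypothesis Hact : smooth_action act.
Implicit Types (x y g h : K) (p m : M) (xi eta zeta : 'rV[R]_k).

Let act1 p : act 1%g p = p. Proof. by case: Hact. Qed.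
Let actM x y p : act (x * y)%g p = act x (act y p). Proof. by case: Hact. Qed.
Let act_smooth2 : smooth_map2 act. Proof. by case: Hact. Qed.

Lemma actK x : cancel (act x) (act x^-1%g).
Proof. by move=> p; rewrite -actM mulVg act1. Qed.

Lemma actVK x : cancel (act x^-1%g) (act x).
Proof. by move=> p; rewrite -actM mulgV act1. Qed.

Lemma act_smooth x : smooth_map (act x).
Proof. exact: smooth_map2_r. Qed.

Lemma orbit_map_smooth p : smooth_map (fun x : K => act x p).
Proof. exact: (smooth_map2_l act_smooth2). Qed.

(** At p = m this is the map L of the overview. *)
Definition orbit_diff p xi : 'rV[R]_n := tmap (fun x : K => act x p) (1%g : K) xi.

Lemma orbit_velocity (g : R -> K) p xi : g 0 = 1%g -> has_velocity g 0 xi ->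
  has_velocity (fun s => act (g s) p) 0 (orbit_diff p xi).
Proof. by move=> g0 gxi; have := has_velocity_map (orbit_map_smooth p) gxi; rewrite g0. Qed.

Lemma infinitesimal_actionE xi p : infinitesimal_action act xi p = orbit_diff p xi.
Proof.
by apply/velocityE/orbit_velocity; [exact: lie_exp0|exact: lie_exp_velocity0].
Qed.

Lemma act_velocity x p (c : R -> M) v : c 0 = p -> has_velocity c 0 v ->
  has_velocity (fun s => act x (c s)) 0 (tmap (act x) p v).
Proof. by move=> <- cv; exact: has_velocity_map (act_smooth x) cv. Qed.

Lemma orbit_exp_velocity xi p t :
  has_velocity (fun s => act (lie_exp K (s *: xi)) p) t
    (tmap (act (lie_exp K (t *: xi))) p (orbit_diff p xi)).
Proof.
apply/has_velocity_shift.
have H := orbit_velocity p (lie_exp0 K xi) (lie_exp_velocity0 K xi).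
have := act_velocity (lie_exp K (t *: xi)) _ H; rewrite lie_exp0 act1 => /(_ _ erefl).
by congr has_velocity; apply/funext => s; rewrite lie_expD actM.
Qed.

Lemma tmap_act_inj x p v : tmap (act x) p v = 0 -> v = 0.
Proof.
move=> v0; have E : act x^-1%g \o act x = id by apply/funext => q /=; rewrite actK.
have := @tmap_comp _ _ _ _ _ _ _ (act x) (act x^-1%g) p v (act_smooth x)
  (act_smooth x^-1%g); rewrite E v0 tmap0 tmap_id; apply.
exact: smooth_map_id.
Qed.

(** Both sides are the velocity at 0 of s |-> x.exp(s xi).p. This is what makes the gauge field of
    an equivariant psi equivariant. *)
Lemma orbit_diff_Ad x p xi :
  orbit_diff (act x p) (Ad x xi) = tmap (act x) p (orbit_diff p xi).
Proof.
have e0 := lie_exp0 K xi; have ev := lie_exp_velocity0 K xi.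
have H1 := orbit_velocity (act x p) _ (conj_velocity x e0 ev).
have H2 := act_velocity x _ (orbit_velocity p e0 ev).
rewrite e0 mulg1 mulgV act1 in H1 H2.
apply: (velocity_unique (H1 erefl)).
have := H2 p erefl; congr has_velocity.
by apply/funext => s; rewrite !actM actK.
Qed.

(** The velocity of exp(s xi).p at time t is the translate by exp(t xi) of its velocity at 0; if the
    latter vanishes, the curve is constant. *)
Lemma lie_stabilizerP p xi :
  lie_subalgebra (stabilizer act p) xi <-> orbit_diff p xi = 0.
Proof.
split=> [H|H].
  have H1 := orbit_velocity p (lie_exp0 K xi) (lie_exp_velocity0 K xi).
  apply: (velocity_unique H1); have := has_velocity_cst p (0 : R).
  by congr has_velocity; apply/funext => s; exact: esym (H s).
move=> t /=; have := @zero_velocity_cst _ _ M setT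
  (fun s => act (lie_exp K (s *: xi)) p) openT (@setT_connected R) _ 0 t I I.
rewrite lie_exp0 act1; apply => s _.
by have := orbit_exp_velocity xi p s; rewrite H tmap0.
Qed.

(** The stabilizer of x.m is the conjugate x H x^-1. *)
Lemma normalizerP m x : normalizer (stabilizer act m) x <->
  stabilizer act (act x m) = stabilizer act m.
Proof.
have E y : stabilizer act (act x m) y <-> stabilizer act m (x^-1 * y * x)%g.
  rewrite /stabilizer /= !actM; split=> [->|H]; first exact: actK.
  by rewrite -[LHS](actVK x) H.
have F : [set (x * h * x^-1)%g | h in stabilizer act m] = stabilizer act (act x m).
  apply/seteqP; split=> [_ [h hm <-]|y /E hm].
    by rewrite /stabilizer /= !actM actK hm.
  by exists (x^-1 * y * x)%g => //; rewrite !mulgA mulgV mul1g -mulgA mulgV mulg1.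
by rewrite /normalizer /= F.
Qed.

(** The clauses express the inclusions of H in x H x^-1 and of x H x^-1 in H. Both are equations
    between points of M depending continuously on x, which yields closedness of the normalizer. *)
Lemma normalizer_closedP m x : normalizer (stabilizer act m) x <->
  (forall h, act h m = m -> act h (act x m) = act x m) /\
  (forall h, act h m = m -> act x (act h (act x^-1%g m)) = m).
Proof.
split=> [/normalizerP E|[H1 H2]].
  split=> h hm.
    by have : stabilizer act (act x m) h by rewrite E.
  suff : stabilizer act (act x m) (x * h * x^-1)%g.
    by rewrite E /stabilizer /= !actM.
  by rewrite /stabilizer /= !actM actK hm.
apply/normalizerP/seteqP; split=> y; last exact: H1.
rewrite /stabilizer /= => yx.
have : act (x^-1 * y * x)%g m = m by rewrite !actM yx actK.
by move=> /H2; rewrite !actM !actVK.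
Qed.

Lemma normalizer_fix m x h : normalizer (stabilizer act m) x -> act h m = m ->
  act h (act x m) = act x m.
Proof. by move=> /normalizer_closedP[H _]; exact: H. Qed.

Lemma stabilizer_normalizer m h : act h m = m -> normalizer (stabilizer act m) h.
Proof. by move=> hm; apply/normalizerP; rewrite hm. Qed.

Lemma normalizerM m x y : normalizer (stabilizer act m) x ->
  normalizer (stabilizer act m) y -> normalizer (stabilizer act m) (x * y)%g.
Proof.
move=> /normalizerP Ex /normalizerP Ey; apply/normalizerP; rewrite -Ex actM.
have E p z : stabilizer act (act x p) z <-> stabilizer act p (x^-1 * z * x)%g.
  rewrite /stabilizer /= !actM; split=> [->|H]; first exact: actK.
  by rewrite -[LHS](actVK x) H.
by apply/seteqP; split=> z /E; rewrite ?Ey => H; apply/E; rewrite ?Ey.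
Qed.

Lemma orbit_diff_normalizer m x xi : normalizer (stabilizer act m) x ->
  orbit_diff m xi = 0 -> orbit_diff (act x m) xi = 0.
Proof. by move=> /normalizerP E /lie_stabilizerP H; apply/lie_stabilizerP; rewrite E. Qed.

(* The curve exp(-t zeta) g(t) m has zero velocity: its increment acts at g(t) m, whose
   stabilizer is that of m. *)
Lemma orbit_exp_eq m (g : R -> K) eta zeta :
  (forall t, normalizer (stabilizer act m) (g t)) -> g 0 = 1%g ->
  (forall s t, act (g (t + s)) m = act (g s) (act (g t) m)) ->
  has_velocity g 0 eta -> orbit_diff m zeta = orbit_diff m eta ->
  forall t, act (lie_exp K (t *: zeta)) m = act (g t) m.
Proof.
move=> gN g0 gD geta Lze t.
pose c t := act (lie_exp K ((- t) *: zeta)) (act (g t) m).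
have c0 s : has_velocity c s (0 : 'rV[R]_n).
  apply/has_velocity_shift.
  have e0 : lie_exp K ((- 0) *: zeta) = 1%g by rewrite oppr0 lie_exp0.
  have H := orbit_velocity (act (g s) m) _
    (mul_velocity1 e0 g0 (lie_exp_velocity0N K zeta) geta).
  have L0 : orbit_diff m (- zeta + eta) = 0.
    by rewrite /orbit_diff tmapD -scaleN1r tmapZ -!/(orbit_diff _ _) Lze scaleN1r addNr.
  rewrite /= oppr0 lie_exp0 g0 mul1g orbit_diff_normalizer // in H.
  have := act_velocity (lie_exp K ((- s) *: zeta)) erefl (H erefl).
  rewrite tmap0; congr has_velocity; apply/funext => r.
  by rewrite /c opprD lie_expD gD !actM.
have := @zero_velocity_cst _ _ M setT c openT (@setT_connected R) (fun s _ => c0 s) 0 t I I.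
rewrite /c oppr0 lie_exp0 g0 !act1 lie_expN => H.
by rewrite -[in LHS]H actVK.
Qed.

Lemma equivariant_orbit_curve (X : M -> 'rV[R]_n) m xi : equivariant_field act X ->
  X m = orbit_diff m xi ->
  integral_curve X m (fun t : R => act (lie_exp K (t *: xi)) m).
Proof.
move=> HXe Xm; split; first by rewrite lie_exp0 act1.
by move=> t; rewrite HXe Xm; exact: orbit_exp_velocity.
Qed.

Lemma equilibrium_normalizer (X : M -> 'rV[R]_n) m xi :
  smooth_vector_field X -> equivariant_field act X -> X m = orbit_diff m xi ->
  forall t : R, normalizer (stabilizer act m) (lie_exp K (t *: xi)).
Proof.
move=> HXs HXe Xm.
have a_curve := equivariant_orbit_curve HXe Xm.
have fixes h t : act h m = m ->
    act h (act (lie_exp K (t *: xi)) m) = act (lie_exp K (t *: xi)) m.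
  move=> hm; apply: (@integral_curve_unique _ _ _ X HXs m
    (fun s => act h (act (lie_exp K (s *: xi)) m)) _ _ a_curve t).
  split; first by rewrite lie_exp0 act1.
  move=> s; rewrite HXe; exact: has_velocity_map (act_smooth h) (a_curve.2 s).
move=> t; apply/normalizer_closedP; split=> h hm; first exact: fixes.
(* The inverse of exp(t xi) is again on the curve, so the second clause reduces to [fixes] at time
   -t. *)
by rewrite -lie_expN fixes // lie_expN actVK.
Qed.

(** The perturbed field is again equivariant, and xi + psi(m) is a velocity of m for it. *)
Lemma gauge_orbit_curve (X : M -> 'rV[R]_n) m xi (psi : M -> 'rV[R]_k) :
  equivariant_field act X -> X m = orbit_diff m xi -> infinitesimal_gauge act psi ->
  integral_curve (fun p => X p + gauge_field act psi p) m
    (fun t : R => act (lie_exp K (t *: (xi + psi m))) m).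
Proof.
move=> HXe Xm [_ psiE]; apply: equivariant_orbit_curve.
  move=> x p; rewrite tmapD -HXe /gauge_field !infinitesimal_actionE psiE.
  by rewrite orbit_diff_Ad.
by rewrite /gauge_field infinitesimal_actionE Xm /orbit_diff tmapD.
Qed.

End SmoothActions.

(** * The frequency torus *)

Section FrequencyTorus.
Context (R : realType) (k n : nat) (K : lieGroupType R k) (M : manifoldType R n).
Context (act : K -> M -> M) (Hact : smooth_action act) (m : M) (xi : 'rV[R]_k).
Hypothesis xiN : forall t : R, normalizer (stabilizer act m) (lie_exp K (t *: xi)).
Implicit Types (x y g h : K) (p : M).

Let act1 p : act 1%g p = p. Proof. by case: Hact. Qed.
Let actM x y p : act (x * y)%g p = act x (act y p). Proof. by case: Hact. Qed.
Let H := stabilizer act m.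

Lemma act_cont x : continuous (act x).
Proof. by have [] := act_smooth Hact x. Qed.

Lemma orbit_map_cont p : continuous (fun x : K => act x p).
Proof. by have [] := orbit_map_smooth Hact p. Qed.

Lemma map_eq_closed (T : topologicalType) (f g : T -> M) : continuous f ->
  continuous g -> closed [set x | f x = g x].
Proof.
move=> cf cg x cx; apply: manifold_hausdorff => U V Ufx Vgx.
have fg_near : nbhs x (f @^-1` U `&` g @^-1` V).
  by apply: filterI; [exact: cf|exact: cg].
have [y [/= fg [Us Vs]]] := cx _ fg_near.
by exists (f y); split => //; rewrite fg.
Qed.

Lemma closed_forall (T : topologicalType) (I : Type) (D : I -> Prop) (A : I -> set T) :
  (forall i, D i -> closed (A i)) -> closed [set x | forall i, D i -> A i x].
Proof.
move=> cA; rewrite (_ : [set x | _] = \bigcap_(i in [set i | D i]) A i).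
  exact: closed_bigI.
by apply/seteqP; split.
Qed.

Lemma normalizer_closed : closed (normalizer H).
Proof.
rewrite (_ : normalizer H = [set x | forall h, act h m = m -> act h (act x m) = act x m]
  `&` [set x | forall h, act h m = m -> act x (act h (act x^-1%g m)) = m]); last first.
  by apply/seteqP; split=> x /(normalizer_closedP Hact).
apply: closedI; apply: closed_forall => h hm.
  apply: map_eq_closed; last exact: orbit_map_cont.
  by move=> x; apply: continuous_comp; [exact: orbit_map_cont|exact: act_cont].
apply: map_eq_closed; last exact: cst_continuous.
have [cact _] : smooth_map2 act by case: Hact.
move=> x; apply: (@continuous_comp _ _ _ (fun x => (x, act h (act x^-1%g m)))
   (fun xy : K * M => act xy.1 xy.2)); last exact: cact.
apply: cvg_pair; first exact: cvg_id.
apply: (@continuous_comp _ _ _ (fun x : K => act x^-1%g m) (act h)); last exact: act_cont.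
apply: (@continuous_comp _ _ _ (fun x : K => x^-1%g) (fun x => act x m)).
  by have [cinv _] := lie_inv_smooth (s := K); exact: cinv.
exact: orbit_map_cont.
Qed.

(* The closed unions of left cosets of H that contain exp(t xi) for all t; their
   intersection is the preimage of the frequency torus in the normalizer. *)
Definition saturated_closed (B : set K) : Prop :=
  [/\ closed B, forall g h, act h m = m -> B g -> B (g * h)%g &
      forall t : R, B (lie_exp K (t *: xi))].

Definition torus_preimage : set K := [set g | forall B, saturated_closed B -> B g].

Lemma normalizer_saturated : saturated_closed (normalizer H).
Proof.
split; [exact: normalizer_closed| |exact: xiN].
move=> g h hm gN; apply: normalizerM => //; exact: stabilizer_normalizer.
Qed.

Lemma torus_preimage_normalizer g : torus_preimage g -> normalizer H g.
Proof. by apply; exact: normalizer_saturated. Qed.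

Lemma torus_preimage_exp (t : R) : torus_preimage (lie_exp K (t *: xi)).
Proof. by move=> B []. Qed.

Lemma torus_preimageMr g h : act h m = m -> torus_preimage g -> torus_preimage (g * h)%g.
Proof. by move=> hm gP B BB; have [_ BH _] := BB; apply: BH => //; exact: gP. Qed.

Lemma lcoset_eqP g g' : lcoset g H = lcoset g' H <-> act g m = act g' m.
Proof.
split=> [E|E].
  have : lcoset g' H g.
    by rewrite -E; exists 1%g; [exact: act1|rewrite mulg1].
  by move=> [h hm <-]; rewrite actM hm.
have sub x y : act x m = act y m -> lcoset x H `<=` lcoset y H.
  move=> xy _ [h hm <-]; exists (y^-1 * (x * h))%g; last by rewrite mulVKg.
  by rewrite /H /stabilizer /= !actM hm xy actK.
by apply/seteqP; split; exact: sub.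
Qed.

(** Closed subsets of N / H and saturated closed subsets of K are exchanged: B yields the cosets of
    elements of N [&] B, and C yields the union of its cosets. Closedness in the subspace N and in K
    match because N is closed. *)
Lemma frequency_torusP g : normalizer H g ->
  (frequency_torus act m xi (lcoset g H) <-> torus_preimage g).
Proof.
move=> gN; split.
  move=> HT B [cB BH Bexp].
  pose C := [set lcoset x H | x in normalizer H `&` B].
  have CE : [set x | C (lcoset x H)] = normalizer H `&` B.
    apply/seteqP; split=> [x [y [yN By] /lcoset_eqP E]|x xNB]; last by exists x.
    have hm : act (y^-1 * x)%g m = m by rewrite actM -E actK.
    rewrite -(mulVKg y x); split; last exact: BH.
    by apply: normalizerM => //; exact: stabilizer_normalizer.
  have : C (lcoset g H).
    apply: HT; split.
      split; first by move=> _ [x [xN _] <-]; exists x.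
      by rewrite CE; apply: closed_subspaceW; apply: closedI => //; exact: normalizer_closed.
    by move=> _ [t _ <-]; exists (lie_exp K (t *: xi)).
  move=> [y [yN By] /lcoset_eqP E].
  rewrite -(mulVKg y g); apply: BH => //.
  by rewrite actM -E actK.
move=> gP C [[CN Ccl] AC].
suff : saturated_closed (normalizer H `&` [set x | C (lcoset x H)]).
  by move=> /gP[].
split.
- have /closed_subspaceP[V cV VE] := Ccl.
  by rewrite setIC -VE; apply: closedI => //; exact: normalizer_closed.
- move=> x h hm [xN Cx]; split.
    by apply: normalizerM => //; exact: stabilizer_normalizer.
  rewrite /=; suff -> : lcoset (x * h)%g H = lcoset x H by [].
  by apply/lcoset_eqP; rewrite actM hm.
- by move=> t; split; [exact: xiN|apply: AC; exists t].
Qed.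

Lemma rmul_cont x : continuous (fun y : K => (y * x)%g).
Proof. by have [] := rmul_smooth x. Qed.

Lemma lmul_cont x : continuous (fun y : K => (x * y)%g).
Proof. by have [] := lmul_smooth x. Qed.

Lemma closed_preim (T S : topologicalType) (f : T -> S) (B : set S) :
  continuous f -> closed B -> closed (f @^-1` B).
Proof. by move=> cf; apply: closed_comp => x _; exact: cf. Qed.

(** Minimality is used twice: first exp(t xi) is fixed on the left and the right factor varies, then
    g' is fixed on the right and the left factor varies. The second set is saturated because g'
    normalizes H: x h g' = x g' (g'^-1 h g'). *)
Lemma torus_preimageM g g' : torus_preimage g -> torus_preimage g' ->
  torus_preimage (g * g')%g.
Proof.
move=> gP g'P.
have step (t : R) y : torus_preimage y -> torus_preimage (lie_exp K (t *: xi) * y)%g.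
  move=> yP B [cB BH Bexp].
  apply: (yP [set y | B (lie_exp K (t *: xi) * y)%g]); split.
  - by apply: closed_preim cB; exact: lmul_cont.
  - by move=> x h hm /= Bx; rewrite mulgA; exact: BH.
  - by move=> s /=; rewrite -lie_expD.
move=> B BB; have [cB BH Bexp] := BB.
apply: (gP [set x | B (x * g')%g]); split.
- by apply: closed_preim cB; exact: rmul_cont.
- move=> x h hm /= Bx.
  rewrite (_ : (x * h * g')%g = (x * g' * (g'^-1 * (h * g')))%g); last first.
    by rewrite !mulgA mulgK.
  apply: BH => //; rewrite !actM.
  by rewrite (normalizer_fix Hact (torus_preimage_normalizer g'P) hm) actK.
- by move=> t /=; apply: step => //.
Qed.

(** Commutation passes from the curve with itself to an element of the preimage with the curve, then
    to two elements, each time by minimality. The elements y commuting with a given a in N form a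
    saturated set because H fixes a.m. *)
Lemma torus_preimage_comm g g' : torus_preimage g -> torus_preimage g' ->
  act g (act g' m) = act g' (act g m).
Proof.
move=> gP g'P.
have sat a : normalizer H a -> (forall t : R, act (lie_exp K (t *: xi)) (act a m) =
    act a (act (lie_exp K (t *: xi)) m)) ->
    saturated_closed [set y | act y (act a m) = act a (act y m)].
  move=> aN aexp; split => //.
  - apply: map_eq_closed; first exact: orbit_map_cont.
    by move=> x; apply: continuous_comp; [exact: orbit_map_cont|exact: act_cont].
  - move=> x h hm /= E; rewrite !actM hm (normalizer_fix Hact aN hm) //.
have expP (t : R) y : torus_preimage y ->
    act y (act (lie_exp K (t *: xi)) m) = act (lie_exp K (t *: xi)) (act y m).
  move=> yP; apply: (yP _ (sat _ (xiN t) _)) => s.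
  by rewrite -!actM -!lie_expD addrC.
apply: (gP _ (sat _ (torus_preimage_normalizer g'P) _)) => t.
by rewrite expP.
Qed.

End FrequencyTorus.

(** * The parametrization E of the frequency torus *)

Section TorusCoordinates.
Context (R : realType) (k n : nat) (K : lieGroupType R k) (M : manifoldType R n).
Context (act : K -> M -> M) (Hact : smooth_action act) (m : M) (xi : 'rV[R]_k).
Hypothesis xiN : forall s : R, normalizer (stabilizer act m) (lie_exp K (s *: xi)).
Context (d : nat) (t : 'I_d -> 'rV[R]_k).
Hypothesis Ht : lattice_basis (normalizer (stabilizer act m)) (stabilizer act m)
            (frequency_torus act m xi) t.

Let act1 p : act 1%g p = p. Proof. by case: Hact. Qed.
Let actM x y p : act (x * y)%g p = act x (act y p). Proof. by case: Hact. Qed.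
Let P := torus_preimage act m xi.
Let L := @orbit_diff R k n K M act m.
Let lcosetP := @lcoset_eqP R k n K M act Hact m.

Let P1 : P 1%g.
Proof. by have := torus_preimage_exp (act := act) (m := m) (xi := xi) 0; rewrite lie_exp0. Qed.

Let PM g g' : P g -> P g' -> P (g * g')%g.
Proof. exact: torus_preimageM. Qed.

Let Pt i (s : R) : P (lie_exp K (s *: t i)).
Proof.
have [tt _ _] := Ht; have [tN tT] := tt i.
by apply/(frequency_torusP Hact xiN); [exact: tN|exact: tT].
Qed.

Let prod_preimage (r : seq 'I_d) (a : 'I_d -> K) : (forall i, P (a i)) ->
  P (\prod_(i <- r) a i)%g.
Proof.
move=> aP; elim: r => [|i r IH]; first by rewrite big_nil.
by rewrite big_cons; exact: PM.
Qed.

Let prod_mul (r : seq 'I_d) (a b : 'I_d -> K) : (forall i, P (a i)) ->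
  (forall i, P (b i)) ->
  act (\prod_(i <- r) (a i * b i))%g m =
  act (\prod_(i <- r) a i)%g (act (\prod_(i <- r) b i)%g m).
Proof.
move=> aP bP; elim: r => [|i r IH]; first by rewrite !big_nil !act1.
rewrite !big_cons !actM IH; congr (act (a i) _).
(* Commutation is available only in front of m: b_i is carried past both remaining products to m,
   then brought back past the product of the b's alone. *)
have := torus_preimage_comm Hact xiN (bP i) (PM (prod_preimage r aP) (prod_preimage r bP)).
by rewrite !actM => ->; rewrite -(torus_preimage_comm Hact xiN (bP i) (prod_preimage r bP)).
Qed.

Definition torus_elt (s : 'rV[R]_d) : K := (\prod_(i < d) lie_exp K (s ord0 i *: t i))%g.

(** The map E of the overview. Additivity in s holds at this level; [torus_elt] is additive only
    modulo H. *)
Definition torus_point (s : 'rV[R]_d) : M := act (torus_elt s) m.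

Lemma torus_elt_preimage s : P (torus_elt s).
Proof. by apply: prod_preimage => i; exact: Pt. Qed.

Lemma torus_elt_normalizer s : normalizer (stabilizer act m) (torus_elt s).
Proof. exact: (torus_preimage_normalizer Hact xiN (torus_elt_preimage s)). Qed.

Lemma torus_elt0 : torus_elt 0 = 1%g.
Proof. by rewrite /torus_elt big1 // => i _; rewrite mxE lie_exp0. Qed.

Lemma torus_pointD s s' : torus_point (s + s') = act (torus_elt s) (torus_point s').
Proof.
have E := prod_mul (index_enum _) (fun i => Pt i (s ord0 i)) (fun i => Pt i (s' ord0 i)).
rewrite /torus_point /torus_elt -E.
by congr act; apply: eq_bigr => i _; rewrite mxE lie_expD.
Qed.

Lemma torus_elt_velocity (v : 'rV[R]_d) :
  has_velocity (fun r : R => torus_elt (r *: v)) 0 (\sum_i v ord0 i *: t i).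
Proof.
pose g (I : seq 'I_d) (r : R) := (\prod_(i <- I) lie_exp K ((r *: v) ord0 i *: t i))%g.
have g0 I : g I 0 = 1%g.
  by rewrite /g big1 // => i _; rewrite scale0r mxE lie_exp0.
suff H (I : seq 'I_d) : has_velocity (g I) 0 (\sum_(i <- I) v ord0 i *: t i) by exact: H.
elim: I => [|i I IH].
  rewrite big_nil; have := has_velocity_cst (1%g : K) 0.
  by congr has_velocity; apply/funext => r; rewrite /g big_nil.
rewrite big_cons.
have vi : has_velocity (fun r : R => lie_exp K ((r *: v) ord0 i *: t i)) 0 (v ord0 i *: t i).
  have [_] := one_parameter_subgroup_scale (v ord0 i) (lie_exp_subgroup K (t i)).
  by congr has_velocity; apply/funext => r; rewrite mxE.
have i0 : lie_exp K (((0 : R) *: v) ord0 i *: t i) = 1%g by rewrite scale0r mxE lie_exp0.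
have := mul_velocity1 i0 (g0 I) vi IH.
by congr has_velocity; apply/funext => r; rewrite /g big_cons.
Qed.

Lemma torus_elt_smooth : smooth_into torus_elt setT.
Proof.
rewrite /torus_elt; elim: (index_enum _) => [|i r IH].
  rewrite (_ : (fun s => _) = (fun=> 1%g)); last by apply/funext => s; rewrite big_nil.
  split=> [s _|q l]; [exact: cst_continuous|exact: Ck_cst].
rewrite (_ : (fun s => _) = (fun s : 'rV[R]_d => (lie_exp K (s ord0 i *: t i) *
    \prod_(j <- r) lie_exp K (s ord0 j *: t j))%g)); last first.
  by apply/funext => s; rewrite big_cons.
apply: (smooth_into_map2 (lie_mul_smooth (s := K))) => //; first exact: openT.
apply: (@smooth_into_precomp _ _ _ _ _ (@coord_fun R d i) (fun r : R => lie_exp K (r *: t i))).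
- exact: R_has_coords.
- exact: coord_fun_continuous.
- by move=> l; apply: Ck_lin; exact: coord_fun_continuous.
- exact: lie_exp_smooth.
Qed.

Lemma torus_point_smooth : smooth_into torus_point setT.
Proof.
exact: (smooth_into_comp openT torus_elt_smooth (orbit_map_smooth Hact m)).
Qed.

Lemma torus_point_cont : continuous torus_point.
Proof. by move=> s; exact: torus_point_smooth.1. Qed.

Lemma torus_point_velocity s v : has_velocity (fun r : R => torus_point (s + r *: v)) 0
  (tmap (act (torus_elt s)) m (L (\sum_i v ord0 i *: t i))).
Proof.
have e0 : torus_elt ((0 : R) *: v) = 1%g by rewrite scale0r torus_elt0.
have H := orbit_velocity Hact m e0 (torus_elt_velocity v).
have := act_velocity Hact (torus_elt s) _ H; rewrite e0 act1 => /(_ _ erefl).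
by congr has_velocity; apply/funext => r; rewrite torus_pointD.
Qed.

(** Translating by [torus_elt s] reduces to s = 0, where the claim is the freeness of t modulo Lie
    H. *)
Lemma torus_point_immersion s v :
  has_velocity (fun r : R => torus_point (s + r *: v)) 0 (0 : 'rV[R]_n) -> v = 0.
Proof.
move=> H; have := velocity_unique (torus_point_velocity s v) H.
move=> /(tmap_act_inj Hact) /(lie_stabilizerP Hact) Hv.
have [_ free _] := Ht.
by apply/rowP => i; rewrite mxE; exact: (free (fun i => v ord0 i) Hv).
Qed.

(** The curve r |-> [torus_elt (r *: c)] is a one-parameter subgroup only modulo H, which is why
    [orbit_exp_eq] asks for additivity on m only. *)
Lemma torus_point_exp (zeta : 'rV[R]_k) (c : 'rV[R]_d) :
  L zeta = L (\sum_i c ord0 i *: t i) ->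
  forall r : R, act (lie_exp K (r *: zeta)) m = torus_point (r *: c).
Proof.
move=> Lz; apply: (orbit_exp_eq Hact (eta := \sum_i c ord0 i *: t i)) => //.
- by move=> r; exact: torus_elt_normalizer.
- by rewrite scale0r torus_elt0.
- by move=> r r'; rewrite addrC scalerDl; exact: torus_pointD.
- exact: torus_elt_velocity.
Qed.

(** Puts the real combinations of the t_i in the Lie algebra of the torus, so that the lattice
    clause of [lattice_basis] applies to them. *)
Lemma torus_exp_preimage (c : 'rV[R]_d) (r : R) :
  P (lie_exp K (r *: \sum_i c ord0 i *: t i)).
Proof.
set eta := \sum_i _; have E := torus_point_exp (zeta := eta) erefl r.
rewrite -(mulVKg (torus_elt (r *: c)) (lie_exp K (r *: eta))).
apply: torus_preimageMr; last exact: torus_elt_preimage.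
by rewrite actM E actK.
Qed.

(** E(s) = exp(eta).m with eta the combination of the t_i with coefficients s_i. The lattice clause
    turns exp(eta) in H into a congruence of eta with an integer combination, and freeness compares
    the coefficients. *)
Lemma torus_point_fix (s : 'rV[R]_d) :
  torus_point s = m <-> exists z : 'I_d -> int, forall i, s ord0 i = (z i)%:~R.
Proof.
have [_ free lat] := Ht; pose eta := \sum_i s ord0 i *: t i.
have etaP r := torus_exp_preimage s r.
have tt_eta : quotient_lie_subalgebra (normalizer (stabilizer act m)) (stabilizer act m)
    (frequency_torus act m xi) eta.
  have etaN r := torus_preimage_normalizer Hact xiN (etaP r).
  by split=> // r; apply/(frequency_torusP Hact xiN); [exact: etaN|exact: etaP].
have E : torus_point s = act (lie_exp K eta) m.
  by rewrite -[s]scale1r -(torus_point_exp (zeta := eta)) // scale1r.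
have H1 : lcoset (1%g : K) (stabilizer act m) = stabilizer act m.
  by apply/seteqP; split=> x; [move=> [h hm <-]; rewrite mul1g|exists x => //; rewrite mul1g].
have sumE (z : 'I_d -> int) : eta - \sum_i t i *~ z i = \sum_i (s ord0 i - (z i)%:~R) *: t i.
  by rewrite /eta -sumrB; apply: eq_bigr => i _; rewrite scalerBl scaler_int.
rewrite E; split=> [Em|[z sz]].
  have : lcoset (lie_exp K eta) (stabilizer act m) = stabilizer act m.
    by rewrite -{2}H1; apply/lcosetP; rewrite act1.
  move=> /(conj tt_eta) /lat[z]; rewrite sumE => /free Hz.
  by exists z => i; apply/eqP; rewrite -subr_eq0; apply/eqP; exact: Hz.
have : exists z, lie_subalgebra (stabilizer act m) (eta - \sum_i t i *~ z i).
  exists z; rewrite sumE big1; last by move=> i _; rewrite sz subrr scale0r.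
  by apply/(lie_stabilizerP Hact); rewrite /orbit_diff tmap0.
move=> /lat[_]; rewrite -{2}H1 => /lcosetP.
by rewrite act1.
Qed.

Lemma torus_point_eqP (s s' : 'rV[R]_d) : torus_point s = torus_point s' <->
  exists z : 'I_d -> int, forall i, s ord0 i - s' ord0 i = (z i)%:~R.
Proof.
have -> : torus_point s = torus_point s' <-> torus_point (s - s') = m.
  have E : torus_point s = act (torus_elt s') (torus_point (s - s')).
    by rewrite -torus_pointD subrKC.
  rewrite E; split=> [H|->] //.
  by rewrite -[LHS](actK Hact (torus_elt s')) H /torus_point actK.
rewrite torus_point_fix.
by split=> -[z Hz]; exists z => i; have := Hz i; rewrite !mxE.
Qed.

End TorusCoordinates.

(** * Density of the frequency line modulo the lattice *)

Section Density.
Context (R : realType) (k n : nat) (K : lieGroupType R k) (M : manifoldType R n).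
Context (act : K -> M -> M) (Hact : smooth_action act) (m : M) (xi : 'rV[R]_k).
Hypothesis xiN : forall s : R, normalizer (stabilizer act m) (lie_exp K (s *: xi)).
Context (d : nat) (t : 'I_d -> 'rV[R]_k).
Hypothesis Ht : lattice_basis (normalizer (stabilizer act m)) (stabilizer act m)
            (frequency_torus act m xi) t.
Context (c : 'rV[R]_d).
Hypothesis xi_coord : orbit_diff act m xi = orbit_diff act m (\sum_i c ord0 i *: t i).

(** The closure of R c + Z^d. *)
Let approx : set 'rV[R]_d := [set s | forall e : R, 0 < e -> exists (r : R) (z : 'I_d -> int),
  forall i, `|r * c ord0 i + (z i)%:~R - s ord0 i| < e].

Let approxD (s s' : 'rV[R]_d) (z : 'I_d -> int) :
  (forall i, s ord0 i - s' ord0 i = (z i)%:~R) -> approx s' -> approx s.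
Proof.
move=> Hz As e e0; have [r [w Hw]] := As e e0; exists r, (fun i => w i + z i) => i.
rewrite intrD -Hz; have := Hw i; congr (`|_| < _); ring.
Qed.

Let cube : set 'rV[R]_d := [set s | forall i, `[0, 1]%classic (s ord0 i : R)].

Let approx_cube_image_closed : closed (torus_point act m t @` (approx `&` cube)).
Proof.
apply: compact_closed; first exact: manifold_hausdorff.
apply: continuous_compact.
  by apply: continuous_subspaceT => s; exact: (torus_point_cont Hact).
rewrite setIC; apply: compact_closedI.
  by apply: (@rV_compact R d (fun=> `[(0 : R), 1]%classic)) => i; exact: segment_compact.
move=> s cs e e0.
have e20 : 0 < e / 2 by rewrite divr_gt0.
have [y [Ay]] := cs _ (nbhsx_ballx s (e / 2) e20).
rewrite -ball_normE /= => sy; have [r [z Hz]] := Ay _ e20.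
exists r, z => i; have := Hz i.
have : `|(s - y) ord0 i| < e / 2 by apply: le_lt_trans sy; exact: row_coord_le.
rewrite !mxE !ltr_norml => /andP[h1 h2] /andP[h3 h4].
by apply/andP; split; lra.
Qed.

(* The g such that g.m = E(y) with y in the closure of R c + Z^d form a saturated closed
   set, which is closed because y may be taken in the unit cube. *)
Lemma frequencies_dense (s : 'rV[R]_d) (e : R) : 0 < e ->
  exists (r : R) (z : 'I_d -> int), forall i, `|r * c ord0 i + (z i)%:~R - s ord0 i| < e.
Proof.
suff : approx s by exact.
have : torus_preimage act m xi (torus_elt K t s) by exact: (torus_elt_preimage Hact xiN Ht).
move=> /(_ [set g | (torus_point act m t @` (approx `&` cube)) (act g m)]).
case; last first.
  by move=> y [Ay _] /esym /(torus_point_eqP Hact xiN Ht) [z Hz]; exact: approxD Hz Ay.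
have actM x y p : act (x * y)%g p = act x (act y p) by case: Hact.
split.
- exact: closed_preim (orbit_map_cont Hact (p := m)) approx_cube_image_closed.
- by move=> g h hm /=; rewrite actM hm.
move=> r /=.
rewrite (torus_point_exp Hact xiN Ht xi_coord).
pose z i := Num.floor (r * c ord0 i).
exists (\row_i (r * c ord0 i - (z i)%:~R)).
  split.
    move=> e' e'0; exists r, (fun i => - z i) => i.
    by rewrite mxE intrN subrr normr0.
  move=> i; rewrite /= in_itv /= mxE subr_ge0 floor_le lerBlDl.
  by apply: ltW; have := floorD1_gt (r * c ord0 i); rewrite intrD.
apply/(torus_point_eqP Hact xiN Ht); exists (fun i => - z i) => i.
by rewrite !mxE intrN; ring.
Qed.

End Density.

(** * The Lie group R^j / Z^j *)

Section StandardTorus.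
Local Open Scope quotient_scope.
Context (R : realType) (j : nat).
Implicit Types (u v w r : 'rV[R]_j).

Definition lattice_rel (v w : 'rV[R]_j) : bool :=
  [forall i, (v - w) ord0 i \is a Num.int].

Lemma lattice_relP v w : reflect (exists z : 'I_j -> int, v - w = \row_i (z i)%:~R)
  (lattice_rel v w).
Proof.
apply: (iffP forallP) => [H|[z ->] i]; last by rewrite mxE intr_int.
exists (fun i => Num.floor ((v - w) ord0 i)); apply/rowP => i.
by rewrite [RHS]mxE floorK.
Qed.

Lemma lattice_rel_refl : reflexive lattice_rel.
Proof. by move=> v; apply/forallP => i; rewrite subrr mxE int_num0. Qed.

Lemma lattice_rel_sym : symmetric lattice_rel.
Proof.
by move=> v w; apply: eq_forallb => i; rewrite -(opprB w v) mxE rpredN.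
Qed.

Lemma lattice_rel_trans : transitive lattice_rel.
Proof.
move=> v u w /forallP uv /forallP vw; apply/forallP => i.
by rewrite -(subrKA v) mxE rpredD.
Qed.

Canonical lattice_equiv :=
  EquivRel lattice_rel lattice_rel_refl lattice_rel_sym lattice_rel_trans.

Definition torus : Type := quotient_topology {eq_quot lattice_equiv}.

HB.instance Definition _ := Quotient.on torus.
HB.instance Definition _ := Topological.on torus.

Definition tpi (v : 'rV[R]_j) : torus := \pi_torus v.

Lemma tpi_eqP v w : tpi v = tpi w <-> exists z : 'I_j -> int, v - w = \row_i (z i)%:~R.
Proof.
split=> [/eqquotP /lattice_relP //|H]; apply/eqquotP; exact/lattice_relP.
Qed.

Lemma tpi_repr (p : torus) : tpi (repr p) = p.
Proof. exact: reprK. Qed.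

Lemma tpi_cont : continuous tpi.
Proof. exact: pi_continuous. Qed.

Lemma translation_cont (b : 'rV[R]_j) : continuous (fun w : 'rV[R]_j => w - b).
Proof.
move=> w; apply: (@cvgB _ _ _ (nbhs w) _ id (fun=> b)); first exact: cvg_id.
exact: cvg_cst.
Qed.

(** The preimage of the image of U is the union of the lattice translates of U. *)
Lemma tpi_open (U : set 'rV[R]_j) : open U -> open (tpi @` U).
Proof.
move=> oU.
suff : open (tpi @^-1` (tpi @` U)) by [].
rewrite openE => v [u Uu /esym/tpi_eqP[z vz]].
have -> : v = u + \row_i (z i)%:~R by rewrite -vz subrKC.
have : nbhs (u + \row_i (z i)%:~R) ((fun w : 'rV[R]_j => w - \row_i (z i)%:~R) @^-1` U).
  by apply: translation_cont; rewrite addrK; exact: open_nbhs_nbhs.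
apply: filterS => w Uw; exists (w - \row_i (z i)%:~R) => //.
by apply/tpi_eqP; exists (fun i => - z i); rewrite addrAC subrr sub0r;
  apply/rowP => i; rewrite !mxE intrN.
Qed.

Lemma tpi_nbhs v (U : set 'rV[R]_j) : nbhs v U -> nbhs (tpi v) (tpi @` U).
Proof.
rewrite nbhsE => -[V [oV Vv] VU]; apply: (@filterS _ _ _ (tpi @` V)); first exact: image_subset.
by apply: open_nbhs_nbhs; split; [exact: tpi_open|exists v].
Qed.

(* The representative of the class of v in the cube of side 1 centered at r. *)
Definition tlift r v : 'rV[R]_j :=
  \row_i (v ord0 i - (Num.floor (v ord0 i - r ord0 i + 1 / 2))%:~R).

Lemma tpi_tlift r v : tpi (tlift r v) = tpi v.
Proof.
apply/tpi_eqP; exists (fun i => - Num.floor (v ord0 i - r ord0 i + 1 / 2)).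
by apply/rowP => i; rewrite !mxE intrN addrAC subrr sub0r.
Qed.

Lemma tlift_tpi r v w : tpi v = tpi w -> tlift r v = tlift r w.
Proof.
move=> /tpi_eqP[z vz]; apply/rowP => i; rewrite !mxE.
have -> : v ord0 i = w ord0 i + (z i)%:~R.
  by have /rowP/(_ i) := vz; rewrite !mxE => <-; rewrite subrKC.
rewrite (_ : _ - r ord0 i + _ = w ord0 i - r ord0 i + 1 / 2 + (z i)%:~R); last by ring.
by rewrite floorDrz ?intr_int // intrKfloor intrD; ring.
Qed.

Lemma tlift_id r w : ball r (1 / 2) w -> tlift r w = w.
Proof.
move=> [_ H]; apply/rowP => i; rewrite mxE.
have := H ord0 i; rewrite -ball_normE /= ltr_norml => /andP[h1 h2].
rewrite (_ : Num.floor _ = 0) ?subr0 //.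
by apply: floor_def; rewrite add0r; apply/andP; split; lra.
Qed.

Section Chart.
Context (r : 'rV[R]_j).
Let W : set 'rV[R]_j := ball r (1 / 2).
Let oW : open W. Proof. exact: ball_open. Qed.

Let cmap (p : torus) : 'rV[R]_j := tlift r (repr p).

Let cmap_tpi w : W w -> cmap (tpi w) = w.
Proof. by move=> Ww; rewrite /cmap (tlift_tpi r (tpi_repr (tpi w))) tlift_id. Qed.

Let cod : cmap @` (tpi @` W) = W.
Proof.
apply/seteqP; split=> [_ [_ [w Ww <-] <-]|w Ww]; first by rewrite cmap_tpi.
by exists (tpi w); [exists w|exact: cmap_tpi].
Qed.

Let cod_open : open (cmap @` (tpi @` W)). Proof. by rewrite cod. Qed.

Let mapK (p : torus) : (tpi @` W) p -> tpi (cmap p) = p.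
Proof. by move=> _; rewrite /cmap tpi_tlift tpi_repr. Qed.

Let map_cont : {within tpi @` W, continuous cmap}.
Proof.
rewrite continuous_open_subspace; last exact: tpi_open.
move=> _ /set_mem[w Ww <-] U; rewrite cmap_tpi // => wU.
have : nbhs (tpi w) (tpi @` (U `&` W)).
  by apply: tpi_nbhs; apply: filterI => //; exact: open_nbhs_nbhs.
by apply: filterS => _ [y [Uy Wy] <-]; rewrite /= cmap_tpi.
Qed.

Let inv_cont : {within cmap @` (tpi @` W), continuous tpi}.
Proof. by apply: continuous_subspaceT => w; exact: tpi_cont. Qed.

(** The inverse of the chart is the projection [tpi] itself, injective on the open cube of side 1
    centered at r. Chart expressions of maps out of the torus are thus read directly on R^j. *)
Definition torus_chart : chart R j torus :=
  Chart (tpi_open oW) cod_open mapK map_cont inv_cont.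

End Chart.

Lemma torus_chart_mapE r v : chart_map (torus_chart r) (tpi v) = tlift r v.
Proof. by rewrite /= (tlift_tpi r (tpi_repr (tpi v))). Qed.

(** The integers subtracted by [tlift] jump only at lattice translates of the faces of the cube,
    which the chart domain excludes. *)
Lemma tlift_local r u : chart_dom (torus_chart r) (tpi u) ->
  exists (O : set 'rV[R]_j) (b : 'rV[R]_j),
    [/\ open O, O u & forall y, O y -> tlift r y = y - b].
Proof.
move=> [w Ww] /esym/tpi_eqP[z uz].
pose b : 'rV[R]_j := \row_i (z i)%:~R.
exists ((fun y => y - b) @^-1` ball r (1 / 2)), b; split.
- rewrite -[X in open X]setTI; apply: open_preimageI; first exact: openT.
    by move=> y _; exact: translation_cont.
  exact: ball_open.
- by rewrite /= /b -uz subKr.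
move=> y yb; rewrite -[RHS](tlift_id yb); apply: tlift_tpi.
by apply/tpi_eqP; exists z; rewrite subKr.
Qed.

(** Common form of the chart changes, the product and the inverse of the torus: a smooth map of
    vectors followed by [tlift]. *)
Lemma tlift_smooth (V : normedModType R) (f : V -> 'rV[R]_j) r (D U : set V) :
  open U -> D `<=` U -> smooth_on f U ->
  (forall x, D x -> chart_dom (torus_chart r) (tpi (f x))) ->
  smooth_on (fun x => tlift r (f x)) D.
Proof.
move=> oU DU sf Dr k; apply: Ck_local => x Dx.
have [Q [b [oQ Qfx Qb]]] := tlift_local (Dr x Dx).
have cf y : U y -> {for y, continuous f} by move=> Uy; exact: (sf 0%N).
have oP : open (U `&` f @^-1` Q) by apply: open_preimageI.
exists (U `&` f @^-1` Q); first by split => //; exact: DU.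
apply: (@Ck_eq _ _ _ _ (fun y => f y + (fun=> - b) y)) => //.
  by move=> y [_ Qy]; rewrite Qb.
apply: CkD => //; last exact: Ck_cst.
by apply: Ck_sub (sf k); exact: subIsetl.
Qed.

End StandardTorus.

(** * Manifold and Lie group structure of the standard torus *)

Section TorusManifold.
Context (R : realType) (j : nat).
Implicit Types (u v w r : 'rV[R]_j) (p q : torus R j).

Definition torus_chart_at (p : torus R j) := torus_chart (repr p : 'rV[R]_j).

Lemma torus_chart_at_dom p : chart_dom (torus_chart_at p) p.
Proof. by exists (repr p); [exact: ballxx|exact: tpi_repr]. Qed.

Lemma smooth_on_id (U : set 'rV[R]_j) : smooth_on id U.
Proof.
move=> k; apply: (@Ck_lin _ _ _ _ (idfun : {linear 'rV[R]_j -> 'rV[R]_j})) => x.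
exact: cvg_id.
Qed.

Lemma torus_chart_compatible p q :
  smoothly_compatible (torus_chart_at p) (torus_chart_at q).
Proof.
rewrite /smoothly_compatible.
rewrite (_ : _ \o _ = fun u => tlift (repr q) (id u)); last first.
  by apply/funext => u; exact: torus_chart_mapE.
apply: (tlift_smooth (U := setT)) => //; first exact: openT.
  exact: smooth_on_id.
move=> _ [x [xp xq] <-].
by rewrite -[tpi _]/(chart_inv (torus_chart_at p) _) chart_mapK.
Qed.

Lemma torus_hausdorff : hausdorff_space (torus R j).
Proof.
move=> p q; rewrite -(tpi_repr p) -(tpi_repr q).
move: (repr p) (repr q) => v w {p q} cl.
apply/tpi_eqP; apply: contrapT => Hn.
have [i Hi] : exists i, (v - w) ord0 i \isn't a Num.int.
  apply: contrapT => H; apply: Hn; apply/lattice_relP/forallP => i.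
  by apply/negPn/negP => Hi; apply: H; exists i.
pose f := Num.floor ((v - w) ord0 i).
pose a := (v - w) ord0 i - f%:~R.
have a0 : 0 < a.
  rewrite lt_neqAle subr_ge0 floor_le andbT eq_sym; apply: contra Hi => /eqP a0.
  by move: a0; rewrite /a => /eqP; rewrite subr_eq0 => /eqP ->; exact: intr_int.
have a1 : a < 1 by rewrite ltrBlDl; have := floorD1_gt ((v - w) ord0 i); rewrite intrD.
(* The number 2 e is the distance from (v - w)_i to the integers. Moving v and w by less than e
   leaves this difference strictly between f and f + 1, so the two projected balls are disjoint. *)
pose e := Num.min a (1 - a) / 2.
have e0 : 0 < e by rewrite divr_gt0 // lt_min a0 subr_gt0.
have [_ [[v' vv' <-] [w' ww' /esym/tpi_eqP[z Hz]]]] :=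
  cl _ _ (tpi_nbhs (nbhsx_ballx v e e0)) (tpi_nbhs (nbhsx_ballx w e e0)).
have {}vv' : `|(v - v') ord0 i| < e.
  by move: vv'; rewrite -ball_normE /=; apply: le_lt_trans; exact: row_coord_le.
have {}ww' : `|(w - w') ord0 i| < e.
  by move: ww'; rewrite -ball_normE /=; apply: le_lt_trans; exact: row_coord_le.
have zi : v' ord0 i - w' ord0 i = (z i)%:~R by have /rowP/(_ i) := Hz; rewrite !mxE.
have ea : 2 * e <= a.
  by rewrite /e mulrC divfK // ge_min lexx.
have ea1 : 2 * e <= 1 - a.
  by rewrite /e mulrC divfK // ge_min lexx orbT.
have fa : v ord0 i - w ord0 i = f%:~R + a by rewrite /a !mxE subrKC.
move: vv' ww'; rewrite !mxE !ltr_norml => /andP[h1 h2] /andP[h3 h4].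
have lt1 : (f - z i)%:~R < (0 : R) by rewrite intrB -zi; lra.
have lt2 : 0 < (f - z i + 1)%:~R :> R by rewrite intrD intrB -zi; lra.
by move: lt1 lt2; rewrite ltrz0 ltr0z ltzD1 leNgt => ->.
Qed.

Lemma torus_second_countable : @second_countable (torus R j).
Proof.
pose b (x : 'rV[rat]_j * nat) : set (torus R j) :=
  @tpi R j @` ball (map_mx ratr x.1 : 'rV[R]_j) (x.2.+1%:R^-1 : R).
exists (range b).
  by apply: sub_countable (card_image_le _ _) _; exact: countableP.
split; first by move=> _ [x _ <-]; apply: tpi_open; exact: ball_open.
move=> p U pU.
have pU' : nbhs (repr p : 'rV[R]_j) (@tpi R j @^-1` U).
  by apply: tpi_cont; rewrite tpi_repr.
have /nbhs_ballP[e /= e0 He] := pU'.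
(* The factor 2 pays for the triangle inequality through the rational center. *)
have [N HN] : exists N : nat, 2 / N.+1%:R < e.
  exists (Num.truncn (2 / e)); rewrite ltr_pdivrMr ?ltr0n // mulrC -ltr_pdivrMr //.
  exact: truncnS_gt.
have N0 : 0 < N.+1%:R^-1 :> R by rewrite invr_gt0 ltr0n.
have rat_near (a dl : R) : 0 < dl -> exists x : rat, `|a - ratr x| < dl.
  move=> dl0; have [|x] := @rat_in_itvoo R (a - dl) (a + dl); first by lra.
  rewrite in_itv /= => /andP[h1 h2]; exists x.
  by rewrite ltr_norml; apply/andP; split; lra.
have /choice[x Hx] (i : 'I_j) := rat_near ((repr p : 'rV[R]_j) ord0 i) _ N0.
have near_x : ball (map_mx ratr (\row_i x i) : 'rV[R]_j) (N.+1%:R^-1 : R) (repr p).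
  split=> // a i; rewrite !mxE -ball_normE /= distrC ord1; exact: Hx.
exists (b (\row_i x i, N)).
  by split; [exists (\row_i x i, N)|exists (repr p); [exact: near_x|exact: tpi_repr]].
move=> _ [y xy <-]; apply: He.
apply: le_ball (ball_triangle (ball_sym near_x) xy).
by rewrite /= -mulr2n -[X in X <= _]mulr_natl ltW.
Qed.

End TorusManifold.

HB.instance Definition _ (R : realType) (j : nat) := isManifold.Build R j (torus R j)
  (@torus_chart_at_dom R j) (@torus_chart_compatible R j) (@torus_hausdorff R j)
  (@torus_second_countable R j).

Section TorusGroup.
Context (R : realType) (j : nat).
Implicit Types (u v w : 'rV[R]_j) (p q : torus R j).

Definition torus_mul p q : torus R j := tpi (repr p + repr q).
Definition torus_one : torus R j := tpi 0.
Definition torus_inv p : torus R j := tpi (- repr p).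

Lemma tpiD v w : torus_mul (tpi v) (tpi w) = tpi (v + w).
Proof.
have /tpi_eqP[z Hz] := tpi_repr (tpi v); have /tpi_eqP[z' Hz'] := tpi_repr (tpi w).
apply/tpi_eqP; exists (fun i => z i + z' i).
rewrite opprD addrACA Hz Hz'; apply/rowP => i; by rewrite !mxE intrD.
Qed.

Lemma tpiN v : torus_inv (tpi v) = tpi (- v).
Proof.
have /tpi_eqP[z Hz] := tpi_repr (tpi v).
apply/tpi_eqP; exists (fun i => - z i).
by rewrite -opprD Hz; apply/rowP => i; rewrite !mxE intrN.
Qed.

Lemma torus_mulC : commutative torus_mul.
Proof. by move=> p q; rewrite /torus_mul addrC. Qed.

Lemma torus_mulA : associative torus_mul.
Proof.
move=> p q r; rewrite -(tpi_repr p) -(tpi_repr q) -(tpi_repr r).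
by rewrite !tpiD addrA.
Qed.

Lemma torus_mul1p : left_id torus_one torus_mul.
Proof. by move=> p; rewrite -(tpi_repr p) tpiD add0r. Qed.

Lemma torus_mulp1 : right_id torus_one torus_mul.
Proof. by move=> p; rewrite torus_mulC torus_mul1p. Qed.

Lemma torus_mulVp : left_inverse torus_one torus_inv torus_mul.
Proof. by move=> p; rewrite -(tpi_repr p) tpiN tpiD addNr. Qed.

Lemma torus_mulpV : right_inverse torus_one torus_inv torus_mul.
Proof. by move=> p; rewrite torus_mulC torus_mulVp. Qed.

End TorusGroup.

HB.instance Definition _ (R : realType) (j : nat) := isGroup.Build (torus R j)
  (@torus_mulA R j) (@torus_mul1p R j) (@torus_mulp1 R j)
  (@torus_mulVp R j) (@torus_mulpV R j).

Section TorusLieGroup.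
Context (R : realType) (j : nat).
Implicit Types (u v w : 'rV[R]_j) (p q : torus R j).

Lemma tpi_mulg v w : (tpi v * tpi w)%g = tpi (v + w).
Proof. exact: tpiD. Qed.

Lemma tpi_invg v : (tpi v)^-1%g = tpi (- v).
Proof. exact: tpiN. Qed.

Lemma addr_cont : continuous (fun uv : 'rV[R]_j * 'rV[R]_j => uv.1 + uv.2).
Proof. by move=> uv; apply: cvgD; [exact: cvg_fst|exact: cvg_snd]. Qed.

Lemma torus_mul_smooth : smooth_map2 (fun p q => (p * q)%g).
Proof.
split=> [[p q] U|p q r].
  rewrite /= -(tpi_repr p) -(tpi_repr q) tpi_mulg => /tpi_cont.
  move=> /(@addr_cont (repr p, repr q))[[A B] /= [pA qB] ABU].
  exists (@tpi R j @` A, @tpi R j @` B); first by split; exact: tpi_nbhs.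
  move=> [_ _] [/= [u Au <-] [v Bv <-]]; rewrite /= tpi_mulg.
  exact: (ABU (u, v)).
rewrite (_ : (fun uv => _) =
    fun uv : 'rV[R]_j * 'rV[R]_j => tlift (repr r) (uv.1 + uv.2)); last first.
  by apply/funext => -[u v] /=; rewrite tpi_mulg; exact: torus_chart_mapE.
apply: (tlift_smooth (U := setT)) => //; first exact: openT.
  move=> l; apply: CkD; first exact: openT.
    by apply: (@Ck_lin _ _ _ _ (fst : {linear _ -> _})) => z; exact: cvg_fst.
  by apply: (@Ck_lin _ _ _ _ (snd : {linear _ -> _})) => z; exact: cvg_snd.
by move=> [u v] [_ _ /=]; rewrite tpi_mulg.
Qed.

Lemma torus_inv_smooth : smooth_map (fun p => (p^-1)%g).
Proof.
split=> [p U|p q].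
  rewrite -(tpi_repr p) tpi_invg => /tpi_cont.
  move=> /(@oppr_continuous _ _ (repr p)) H.
  apply: filterS (tpi_nbhs H) => _ [u Uu <-] /=.
  by rewrite tpi_invg.
rewrite (_ : _ \o _ = fun u : 'rV[R]_j => tlift (repr q) (- u)); last first.
  by apply/funext => u; rewrite /= tpi_invg; exact: torus_chart_mapE.
apply: (tlift_smooth (U := setT)) => //; first exact: openT.
  by move=> l; apply: (@Ck_lin _ _ _ _ (-%R : {linear _ -> _})); exact: oppr_continuous.
move=> _ [x [xp xq] <-]; rewrite -tpi_invg.
by rewrite -[tpi _]/(chart_inv (torus_chart_at p) _) chart_mapK.
Qed.

End TorusLieGroup.

HB.instance Definition _ (R : realType) (j : nat) :=
  Manifold_Group_isLieGroup.Build R j (torus R j)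
    (@torus_mul_smooth R j) (@torus_inv_smooth R j).

Lemma setT_rV_connected (R : realType) j : connected [set: 'rV[R]_j].
Proof.
have -> : [set: 'rV[R]_j] = \bigcup_(v in [set: 'rV[R]_j])
    ((fun s : R => s *: v) @` [set: R]).
  by apply/seteqP; split=> // v _; exists v => //; exists 1; rewrite ?scale1r.
apply: bigcup_connected; first by exists 0 => v _; exists 0; rewrite ?scale0r.
move=> v _; apply: connected_continuous_connected; first exact: setT_connected.
by apply: continuous_subspaceT => s; exact: scalel_continuous.
Qed.

Lemma tpi_surj (R : realType) j : [set: torus R j] = range (@tpi R j).
Proof. by apply/seteqP; split=> // p _; exists (repr p) => //; exact: tpi_repr. Qed.

Lemma torus_is_torus (R : realType) j : is_torus (torus R j).
Proof.
split; last by move=> p q; exact: torus_mulC.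
- have -> : [set: torus R j] =
      @tpi R j @` [set v : 'rV[R]_j | forall i, `[(0 : R), 1]%classic (v ord0 i : R)].
    apply/seteqP; split=> // p _.
    (* Centering the unit cube at (1/2, ..., 1/2) makes [tlift] the coordinatewise fractional
       part. *)
    exists (tlift (\row_i (1 / 2)) (repr p)); last by rewrite tpi_tlift tpi_repr.
    move=> i; rewrite /= in_itv /= !mxE subrK.
    have /andP[h1 h2] := floor_itv ((repr p : 'rV[R]_j) ord0 i).
    by rewrite intrD in h2; apply/andP; split; lra.
  apply: continuous_compact.
    by apply: continuous_subspaceT => v; exact: tpi_cont.
  by apply: (@rV_compact R j (fun=> `[(0 : R), 1]%classic)) => i; exact: segment_compact.
- rewrite tpi_surj; apply: connected_continuous_connected.
    exact: setT_rV_connected.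
  by apply: continuous_subspaceT => v; exact: tpi_cont.
Qed.

(** * The subtorus of the first j frequencies *)

Section RowExtension.
Context (R : realType) (j d : nat) (Hj : (j <= d)%N).
Implicit Types (v w : 'rV[R]_j).

(** Padding by zeros, written as a combination of fixed basis vectors so that smoothness follows
    term by term. *)
Definition row_ext v : 'rV[R]_d :=
  \sum_(a < j) v ord0 a *: delta_mx 0 (widen_ord Hj a).

Lemma row_ext_widen v a : row_ext v ord0 (widen_ord Hj a) = v ord0 a.
Proof.
rewrite summxE (bigD1 a) //= big1 => [|b ba]; rewrite !mxE !eqxx /=.
  by rewrite mulr1 addr0.
by rewrite -val_eqE /= eq_sym val_eqE (negbTE ba) mulr0.
Qed.

Lemma row_ext_ge v (i : 'I_d) : (j <= i)%N -> row_ext v ord0 i = 0.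
Proof.
move=> ji; rewrite summxE big1 // => a _; rewrite !mxE eqxx /=.
rewrite -val_eqE /= gtn_eqF ?mulr0 //; exact: leq_trans ji.
Qed.

Variant row_ext_spec (i : 'I_d) : Type :=
  | RowExtWiden a of i = widen_ord Hj a
  | RowExtGe of (j <= i)%N.

Lemma row_extP i : row_ext_spec i.
Proof.
case: (ltnP i j) => [ij|]; last exact: RowExtGe.
by apply: (@RowExtWiden i (Ordinal ij)); apply/val_inj.
Qed.

Lemma row_ext_line u v (s : R) : row_ext (u + s *: v) = row_ext u + s *: row_ext v.
Proof.
rewrite /row_ext scaler_sumr -big_split; apply: eq_bigr => a _ /=.
by rewrite scalerA -scalerDl !mxE.
Qed.

Lemma row_ext_smooth k : Ck k row_ext setT.
Proof.
apply: Ck_sum => [|a]; first exact: openT.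
apply: (Ck_scale openT); last exact: Ck_cst.
by apply: (@Ck_lin _ _ _ _ (@coord_fun R j a : {linear _ -> _})); exact: coord_fun_continuous.
Qed.

Lemma row_ext_cont : continuous row_ext.
Proof. by move=> v; exact: (row_ext_smooth 0). Qed.

End RowExtension.

Section SubTorus.
Context (R : realType) (k n : nat) (K : lieGroupType R k) (M : manifoldType R n).
Context (act : K -> M -> M) (Hact : smooth_action act) (m : M) (xi : 'rV[R]_k).
Hypothesis xiN : forall s : R, normalizer (stabilizer act m) (lie_exp K (s *: xi)).
Context (d : nat) (t : 'I_d -> 'rV[R]_k).
Hypothesis Ht : lattice_basis (normalizer (stabilizer act m)) (stabilizer act m)
            (frequency_torus act m xi) t.
Context (j : nat) (Hj : (j <= d)%N).

Let pt v : M := torus_point act m t (row_ext Hj v).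

Definition subtorus_map (p : torus R j) : M := pt (repr p).

Lemma subtorus_point_eqP (v w : 'rV[R]_j) : pt v = pt w <-> tpi v = tpi w.
Proof.
rewrite tpi_eqP (torus_point_eqP Hact xiN Ht); split=> [[z Hz]|[z Hz]].
  exists (fun a => z (widen_ord Hj a)); apply/rowP => a.
  by have := Hz (widen_ord Hj a); rewrite !row_ext_widen !mxE.
suff /choice[f Hf] : forall i, exists z : int,
    row_ext Hj v ord0 i - row_ext Hj w ord0 i = z%:~R by exists f.
move=> i; have [a ->|ji] := row_extP Hj i.
  exists (z a); rewrite !row_ext_widen.
  by have /rowP/(_ a) := Hz; rewrite !mxE.
by exists 0; rewrite !row_ext_ge // subrr.
Qed.

Lemma subtorus_map_tpi v : subtorus_map (tpi v) = pt v.
Proof. by apply/subtorus_point_eqP; exact: tpi_repr. Qed.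

Lemma subtorus_point_smooth : smooth_into pt setT.
Proof.
apply: (@smooth_into_precomp _ _ _ _ _ (row_ext Hj) (torus_point act m t)).
- exact: rV_has_coords.
- exact: row_ext_cont.
- exact: row_ext_smooth.
- exact: torus_point_smooth.
Qed.

Lemma subtorus_map_cont : continuous subtorus_map.
Proof.
move=> p U pU; rewrite -(tpi_repr p).
have : nbhs (repr p : 'rV[R]_j) (pt @^-1` U) by exact: (subtorus_point_smooth.1 _ I).
move=> /tpi_nbhs; apply: filterS => _ [v Uv <-] /=.
by rewrite subtorus_map_tpi.
Qed.

Lemma subtorus_map_smooth : smooth_map subtorus_map.
Proof.
split=> [|p q k']; first exact: subtorus_map_cont.
(* Torus charts have [tpi] as inverse, so the chart expression is that of [pt], smooth on all of
   R^j. *)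
rewrite (_ : _ \o _ = chart_map (chart_at q) \o pt); last first.
  by apply/funext => v; congr (chart_map _ _); exact: subtorus_map_tpi.
apply: Ck_sub (subtorus_point_smooth.2 q k') => _ [x [xp xq] <-]; split => //=.
rewrite -subtorus_map_tpi -[tpi _]/(chart_inv (torus_chart_at p) _).
by rewrite chart_mapK.
Qed.

Lemma subtorus_map_inj : injective subtorus_map.
Proof.
by move=> p q /subtorus_point_eqP; rewrite !tpi_repr.
Qed.

Lemma subtorus_map_immersion p v : tmap subtorus_map p v = 0 -> v = 0.
Proof.
move=> Hv; pose u : 'rV[R]_j := chart_map (chart_at p) p.
have tu : tpi u = p by apply: (@chart_mapK _ _ _ (chart_at p)); exact: chart_at_dom.
(* A coordinate line of the torus is the projection of a straight line, so the immersion property of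
   E along lines applies to its image. *)
have : has_velocity (fun s : R => tpi (u + s *: v) : torus R j) 0 v.
  exact: chart_line_velocity p v.
move=> /(has_velocity_map subtorus_map_smooth); rewrite /= scale0r addr0 tu.
rewrite Hv (_ : _ \o _ = fun s : R => torus_point act m t (row_ext Hj u + s *: row_ext Hj v)).
  move=> /(torus_point_immersion Hact xiN Ht) v0.
  by apply/rowP => a; rewrite -(row_ext_widen Hj) v0 !mxE.
apply/funext => s /=; rewrite -row_ext_line; exact: subtorus_map_tpi.
Qed.

Context (x : 'I_d -> R).
Hypothesis xi_coord : orbit_diff act m xi = orbit_diff act m (\sum_i x i *: t i).

Let xj : 'rV[R]_j := \row_a x (widen_ord Hj a).

Lemma subtorus_closure :
  range subtorus_map = closure (range (fun r : R => torus_point act m t (r *: row_ext Hj xj))).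
Proof.
have [cT _ _] := torus_is_torus R j.
have pt_line (r : R) : torus_point act m t (r *: row_ext Hj xj) = pt (r *: xj).
  rewrite /pt; congr torus_point.
  by apply/rowP => i; rewrite mxE; have [a ->|ji] := row_extP Hj i;
    rewrite ?row_ext_widen ?mxE // !row_ext_ge // mulr0.
apply/seteqP; split=> [_ [p _ <-]|].
  rewrite -(tpi_repr p) subtorus_map_tpi => U.
  move=> /(subtorus_point_smooth.1 _ I) /nbhs_ballP[e /= e0 He].
  pose c : 'rV[R]_d := \row_i x i.
  have xi_c : orbit_diff act m xi = orbit_diff act m (\sum_i c ord0 i *: t i).
    by rewrite xi_coord; congr orbit_diff; apply: eq_bigr => i _; rewrite mxE.
  (* The density in R^d modulo Z^d is applied to the padded point, and only the first j coordinates
     of the approximation are kept. *)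
  have [r [z Hz]] := frequencies_dense Hact xiN Ht xi_c (row_ext Hj (repr p)) e0.
  pose w : 'rV[R]_j := r *: xj + \row_a (z (widen_ord Hj a))%:~R.
  exists (pt w); split; last first.
    apply: He; split => // i0 a; rewrite ord1 -ball_normE /= distrC.
    by have := Hz (widen_ord Hj a); rewrite row_ext_widen !mxE.
  exists r => //; rewrite pt_line; apply/subtorus_point_eqP/tpi_eqP.
  exists (fun a => - z (widen_ord Hj a)); rewrite /w opprD addrA subrr sub0r.
  by apply/rowP => a; rewrite !mxE intrN.
(* The other inclusion: the image of the compact torus is closed and contains the line. *)
have cl : closed (range subtorus_map).
  apply: compact_closed; first exact: manifold_hausdorff.
  apply: continuous_compact => //.
  by apply: continuous_subspaceT => p; exact: subtorus_map_cont.
rewrite closureE; apply: smallest_sub => // _ [r _ <-].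
by exists (tpi (r *: xj)) => //; rewrite subtorus_map_tpi pt_line.
Qed.

End SubTorus.

Theorem proposition3p8 (R : realType) (k n : nat)
    (K : lieGroupType R k) (HK : compact [set: K])
    (M : manifoldType R n)
    (act : K -> M -> M) (Hact : smooth_action act)
    (X : M -> 'rV[R]_n)
    (HXs : smooth_vector_field X) (HXe : equivariant_field act X)
    (m : M) (Hm : relative_equilibrium act X m)
    (xi : 'rV[R]_k) (Hxi : is_velocity act X m xi)
    (d : nat) (Hd0 : (0 < d)%N)
    (Hd : quotient_dim (normalizer (stabilizer act m)) (stabilizer act m)
            (frequency_torus act m xi) d)
    (t : 'I_d -> 'rV[R]_k)
    (Ht : lattice_basis (normalizer (stabilizer act m)) (stabilizer act m)
            (frequency_torus act m xi) t)
    (x : 'I_d -> R)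
    (Hx : lie_subalgebra (stabilizer act m) (xi - \sum_(i < d) x i *: t i))
    (j : nat) (Hj : (j <= d)%N)
    (psi : M -> 'rV[R]_k) (Hpsi : infinitesimal_gauge act psi)
    (Hpsim : lie_subalgebra (stabilizer act m)
               (psi m - - \sum_(i < d | (j <= i)%N) x i *: t i)) :
  stabilizes_frequencies act X m psi j.
Proof.
have Xm : X m = orbit_diff act m xi by rewrite -infinitesimal_actionE.
have xiN := equilibrium_normalizer Hact HXs HXe Xm.
have diff0 eta zeta : lie_subalgebra (stabilizer act m) (eta - zeta) ->
    orbit_diff act m eta = orbit_diff act m zeta.
  move=> /(lie_stabilizerP Hact); rewrite /orbit_diff tmapD -scaleN1r tmapZ scaleN1r.
  by move=> /eqP; rewrite subr_eq0 => /eqP.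
have xi_coord := diff0 _ _ Hx; have psi_coord := diff0 _ _ Hpsim.
pose xj : 'rV[R]_j := \row_a x (widen_ord Hj a).
(* Elements of ['I_d] start at 0, so the indices i >= j are those of t_{j+1}, ..., t_d; adding
   psi(m) cancels exactly these coordinates of xi modulo Lie H. *)
have zeta_coord : orbit_diff act m (xi + psi m) =
    orbit_diff act m (\sum_i row_ext Hj xj ord0 i *: t i).
  rewrite {1}/orbit_diff tmapD -!/(orbit_diff _ _ _) xi_coord psi_coord.
  rewrite /orbit_diff -tmapD; congr tmap.
  rewrite (bigID (fun i : 'I_d => (j <= i)%N)) /= addrAC subrr add0r.
  rewrite [RHS](bigID (fun i : 'I_d => (j <= i)%N)) /= [X in _ = X + _]big1 ?add0r.
    apply: eq_bigr => i; have [a -> _|->//] := row_extP Hj i.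
    by rewrite row_ext_widen mxE.
  by move=> i ji; rewrite row_ext_ge // scale0r.
exists (fun r : R => act (lie_exp K (r *: (xi + psi m))) m); split.
  exact: gauge_orbit_curve.
exists (torus R j), (subtorus_map act m t Hj); split.
- exact: torus_is_torus.
- exact: (subtorus_map_smooth Hact xiN Ht).
- exact: (subtorus_map_inj Hact xiN Ht).
- exact: (subtorus_map_immersion Hact xiN Ht).
- rewrite (subtorus_closure Hact xiN Ht Hj xi_coord).
  apply: (congr1 (fun f : R -> M => closure (range f))).
  by apply/funext => r; rewrite (torus_point_exp Hact xiN Ht zeta_coord).
Qed.
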